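(* Consider the saddle-point problem $\min_{x\in\mathcal X}\max_{y\in\mathcal Y}S(x,y)$ described in the context, with $\mu>0$ and with exact (deterministic) gradients of $f$, $\Phi(\cdot,y)$, $\Phi(x,\cdot)$ available. Assume that $\mathcal B(0,1)\triangleq\{x\in\mathbb X:\|x\|\le1\}\subseteq\operatorname{dom}h_{\mathcal X}$, that $\mathcal X$ is bounded and that $\Omega_{h_{\mathcal Y}}<+\infty$. Run the deterministic restart scheme of the context with diameter estimate $U\ge D_{\mathcal X}$. Then for any desired accuracy $\epsilon\in(0,\mu U^2/4]$, $$G(x_{K+1},y_{K+1})\le\epsilon,$$ and the total number of oracle calls $C^{\rm det}_\epsilon=\sum_{k=1}^KT_k$ satisfies $$\begin{aligned}C^{\rm det}_\epsilon\le{}&\Big(3+64\sqrt{(L/\mu)\Omega'_{h_{\mathcal X}}}+1024(L_{xx}/\mu)\Omega'_{h_{\mathcal X}}\Big)\Big(\big\lceil\log_2\big(\mu U^2/(4\epsilon)\big)\big\rceil+1\Big)\\&+8192\big(L_{yx}/\sqrt{\mu\epsilon}\big)\sqrt{\Omega'_{h_{\mathcal X}}\Omega_{h_{\mathcal Y}}}+2048\big(L_{yy}/\epsilon\big)\Omega_{h_{\mathcal Y}}.\end{aligned}$$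
   Context: **Problem.** $\mathbb X,\mathbb Y$ are finite-dimensional real normed spaces with duals $\mathbb X^*,\mathbb Y^*$; $\|\cdot\|$ and $\|\cdot\|_*$ denote primal and dual norms, $\langle\cdot,\cdot\rangle$ the duality pairing. $\mathcal X\subseteq\mathbb X$, $\mathcal Y\subseteq\mathbb Y$ are nonempty closed convex sets, and $S(x,y)\triangleq f(x)+g(x)+\Phi(x,y)-J(y)$, where $f,g:\mathbb X\to(-\infty,+\infty]$ and $J:\mathbb Y\to(-\infty,+\infty]$ are convex, closed and proper (CCP), $\operatorname{dom}g\cap\mathcal X\neq\emptyset$, $\operatorname{dom}J\cap\mathcal Y\ne\emptyset$. $f$ is differentiable on an open set containing $\mathcal X$, $\nabla f$ is $L$-Lipschitz on $\mathcal X$, and $f(x)\ge f(x')+\langle\nabla f(x'),x-x'\rangle+\frac\mu2\|x-x'\|^2$ for $x,x'\in\mathcal X$. $\Phi$ is convex in $x$, concave in $y$, differentiable on an open set containing $\mathcal X\times\mathcal Y$, and for all $x,x'\in\mathcal X$, $y,y'\in\mathcal Y$: $\|\nabla_x\Phi(x,y)-\nabla_x\Phi(x',y)\|_*\le L_{xx}\|x-x'\|$, $\|\nabla_x\Phi(x,y)-\nabla_x\Phi(x,y')\|_*\le L_{yx}\|y-y'\|$, $\|\nabla_y\Phi(x,y)-\nabla_y\Phi(x',y)\|_*\le L_{yx}\|x-x'\|$, $\|\nabla_y\Phi(x,y)-\nabla_y\Phi(x,y')\|_*\le L_{yy}\|y-y'\|$. A saddle point $(x^*,y^* )\in\mathcal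 X\times\mathcal Y$ (i.e. $S(x^*,y)\le S(x^*,y^* )\le S(x,y^* )$ on $\mathcal X\times\mathcal Y$) exists. Duality gap: $G(x,y)\triangleq\sup_{x'\in\mathcal X,y'\in\mathcal Y}[S(x,y')-S(x',y)]$. $D_{\mathcal U}\triangleq\sup_{u,u'\in\mathcal U}\|u-u'\|$. **Distance generating functions (DGFs).** For a nonempty closed convex set $\mathcal U$, a CCP function $h_{\mathcal U}$ is a DGF on $\mathcal U$ if it is continuous on $\mathcal U$, essentially smooth (continuously differentiable on $\operatorname{int}\operatorname{dom}h_{\mathcal U}\neq\emptyset$ with $\|\nabla h_{\mathcal U}(u^k)\|_*\to\infty$ whenever $u^k\in\operatorname{int}\operatorname{dom}h_{\mathcal U}$ converges to a boundary point of $\operatorname{dom}h_{\mathcal U}$), and $D_{h_{\mathcal U}}(u,u')\triangleq h_{\mathcal U}(u)-h_{\mathcal U}(u')-\langle\nabla h_{\mathcal U}(u'),u-u'\rangle\ge\frac12\|u-u'\|^2$ for $u\in\mathcal U$, $u'\in\mathcal U^o\triangleq\mathcal U\cap\operatorname{int}\operatorname{dom}h_{\mathcal U}$. $h_{\mathcal X}$, $h_{\mathcal Y}$ are fixed DGFs on $\mathcal X,\mathcal Y$. $\Omega_{h_{\mathcal Y}}\triangleq\sup_{y\in\mathcal Y,y'\in\mathcal Y^o}D_{h_{\mathcal Y}}(y,y')$ and $\Omega'_{h_{\mathcal X}}\triangleq\sup_{z\in\mathcal B(0,1)}D_{h_{\mathcal X}}(z,0)<+\infty$. For $x_{\rm c}\in\mathcal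 X^o$, $R>0$, the rescaled DGF is $\tilde h_{x_{\rm c},R}(x)\triangleq R^2h_{\mathcal X}((x-x_{\rm c})/R)$, with Bregman distance $D_{\tilde h_{x_{\rm c},R}}$. Standing conventions: $D_{\tilde h_{x_{\rm c},R}}(x,x')\ge\frac12\|x-x'\|^2$ for $x\in\mathcal X\cap\operatorname{dom}\tilde h_{x_{\rm c},R}$, $x'\in\mathcal X\cap\operatorname{int}\operatorname{dom}\tilde h_{x_{\rm c},R}$; all minimization subproblems below have unique solutions lying in the interior of the domain of the DGF used and in $\operatorname{dom}g$ (resp. $\operatorname{dom}J$); and the denominators in the stepsizes are positive. **Subroutine** (inputs: $x^0$, $R>0$, number $T$, sequences $\beta_t,\alpha_t,\tau_t,\theta_t$). Set $x^1=\bar x^1=x^0$, $y^1=\bar y^1\in\mathcal Y^o$, $s^1=\nabla_y\Phi(x^1,y^1)$. For $t=1,\dots,T-1$: - $y^{t+1}=\arg\min_{y\in\mathcal Y}J(y)-\langle s^t,y-y^t\rangle+\alpha_t^{-1}D_{h_{\mathcal Y}}(y,y^t)$; - $\tilde x^{t+1}=(1-\beta_t)\bar x^t+\beta_tx^t$; - $x^{t+1}=\arg\min_{x\in\mathcal X}g(x)+\langle\nabla_x\Phi(x^t,y^{t+1})+\nabla f(\tilde x^{t+1}),x-x^t\rangle+\tau_t^{-1}D_{\tilde h_{x^1,R}}(x,x^t)$; - $s^{t+1}=(1+\theta_{t+1})\nabla_y\Phi(x^{t+1},y^{t+1})-\theta_{t+1}\nabla_y\Phi(x^t,y^t)$; -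 $\bar x^{t+1}=(1-\beta_t)\bar x^t+\beta_tx^{t+1}$, $\ \bar y^{t+1}=(1-\beta_t)\bar y^t+\beta_ty^{t+1}$. Output $(\bar x^T,\bar y^T)$. **Deterministic restart scheme.** Inputs: $U\ge D_{\mathcal X}$, $\epsilon>0$, $x_1\in\mathcal X^o$; $K=\lceil\max\{0,\log_2(\mu U^2/(4\epsilon))\}\rceil+1$. Set $R_1=2U$. For $k=1,\dots,K$: 1. $T_k=\Big\lceil\max\big\{3,\ 64\sqrt{(L/\mu)\Omega'_{h_{\mathcal X}}},\ 1024(L_{xx}/\mu)\Omega'_{h_{\mathcal X}},\ 4096L_{yx}(\mu R_k)^{-1}\sqrt{\Omega'_{h_{\mathcal X}}\Omega_{h_{\mathcal Y}}},\ 8192L_{yy}(\mu R_k^2)^{-1}\Omega_{h_{\mathcal Y}}\big\}\Big\rceil$. 2. Run the subroutine with $x^0=x_k$, $R=R_k$, $T=T_k$, $\theta_t=(t-1)/t$, $\beta_t=2/(t+1)$, $\alpha_t=\alpha$, $\tau_t=t\tau$, where $\alpha=1/\big(16(\eta^{-1}L_{yx}+L_{yy})\big)$, $\tau=1/\big(4L+2(L_{xx}+\eta L_{yx})T\big)$, $\eta=(4/R)\sqrt{\Omega_{h_{\mathcal Y}}/\Omega'_{h_{\mathcal X}}}$. Denote its output by $(\bar x_k^{T_k},\bar y_k^{T_k})$. 3. $R_{k+1}=R_k/\sqrt2$, $x_{k+1}=\bar x_k^{T_k}$, $y_{k+1}=\bar y_k^{T_k}$. Output $(x_{K+1},y_{K+1})$.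 *)

(* Defs.v *)
From HB Require Import structures.
From mathcomp Require Import all_boot all_order all_algebra.
From mathcomp Require Import all_classical all_reals all_analysis.

Set Implicit Arguments.
Unset Strict Implicit.
Unset Printing Implicit Defensive.
Import Order.TTheory GRing.Theory Num.Theory.
Import numFieldNormedType.Exports.

Local Open Scope classical_set_scope.
Local Open Scope ring_scope.

Section Convex.
Context {R : realType} {V : normedModType R}.

Definition finite_dimensional : Prop :=
  exists (n : nat) (b : 'I_n -> V),
    forall v, exists c : 'I_n -> R, v = \sum_(i < n) c i *: b i.

(* An element of the dual of V is represented by the underlying function
   V -> R, and the pairing <phi, v> is the application phi v. *)
Definition dual_norm (phi : V -> R) : \bar R :=
  ereal_sup [set `|phi v|%:E | v in [set v : V | `|v| <= 1]].

Definition diameter (A : set V) : \bar R :=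
  ereal_sup [set d | exists u v, [/\ A u, A v & d = `|u - v|%:E]].

Definition edom (f : V -> \bar R) : set V := [set v | (f v < +oo)%E].

Record ccp (f : V -> \bar R) : Prop := Ccp {
  ccp_convex : forall (u v : V) (t : R), 0 <= t <= 1 ->
    (f (t *: u + (1 - t) *: v)%R <= t%:E * f u + (1 - t)%:E * f v)%E;
  ccp_closed : lower_semicontinuous f;
  ccp_gt_ninfty : forall v, (-oo < f v)%E;
  ccp_dom : edom f !=set0 }.

(* Gradient of an extended-real-valued function, as a linear form; it is only
   used at interior points of the domain. *)
Definition grad (f : V -> \bar R) (v : V) : V -> R :=
  'd (fun w => fine (f w) : R^o) v.

Definition bregman (h : V -> \bar R) (u v : V) : \bar R :=
  (h u - h v - (grad h v (u - v))%:E)%E.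

Definition dgf_interior (U : set V) (h : V -> \bar R) : set V :=
  U `&` (edom h)°.

Record essentially_smooth (h : V -> \bar R) : Prop := EssentiallySmooth {
  es_int : (edom h)° !=set0;
  es_differentiable : forall u, (edom h)° u ->
    differentiable (fun w => fine (h w) : R^o) u;
  es_continuous_grad : forall u, (edom h)° u ->
    dual_norm (fun w => grad h v w - grad h u w) @[v --> u] --> 0%E;
  es_steep : forall (u : nat -> V) (p : V),
    (forall k, (edom h)° (u k)) ->
    (closure (edom h) `\` (edom h)°) p ->
    u k @[k --> \oo] --> p ->
    dual_norm (grad h (u k)) @[k --> \oo] --> +oo%E }.

Record dgf (U : set V) (h : V -> \bar R) : Prop := Dgf {
  dgf_ccp : ccp h;
  dgf_continuous : {within U, continuous h};
  dgf_essentially_smooth : essentially_smooth h;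
  dgf_strongly_convex : forall u v, U u -> dgf_interior U h v ->
    ((2^-1 * `|u - v| ^+ 2)%:E <= bregman h u v)%E }.

Definition rescaled (h : V -> \bar R) (c : V) (r : R) (v : V) : \bar R :=
  ((r ^+ 2)%:E * h (r^-1 *: (v - c))%R)%E.

Definition rescaled_strongly_convex (U : set V) (h : V -> \bar R) : Prop :=
  forall (c : V) (r : R), dgf_interior U h c -> 0 < r ->
  forall u v, (U `&` edom (rescaled h c r)) u ->
    dgf_interior U (rescaled h c r) v ->
    ((2^-1 * `|u - v| ^+ 2)%:E <= bregman (rescaled h c r) u v)%E.

Definition Omega (U : set V) (h : V -> \bar R) : \bar R :=
  ereal_sup [set d | exists u v,
    [/\ U u, dgf_interior U h v & d = bregman h u v]].

Definition Omega' (h : V -> \bar R) : \bar R :=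
  ereal_sup [set bregman h z 0 | z in [set z : V | `|z| <= 1]].

Definition minimizer (A : set V) (F : V -> \bar R) (p : V) : Prop :=
  A p /\ forall q, A q -> (F p <= F q)%E.

(* p = argmin_A F, with the standing convention that the minimizer is unique and
   lies in D: below, D is the intersection of the interior of the domain of the
   distance generating function with the domain of g or J. *)
Definition is_argmin (A D : set V) (F : V -> \bar R) (p : V) : Prop :=
  [/\ minimizer A F p, forall q, minimizer A F q -> q = p & D p].

End Convex.

Arguments finite_dimensional {R} V.

Section SaddlePoint.
Context {R : realType} {X Y : normedModType R}.

(* Phi is only constrained near the product of the two feasible sets, where it
   is finite, hence it is taken real-valued. *)
Record spp : Type := Spp {
  Xset : set X;
  Yset : set Y;
  f_ : X -> \bar R;
  g_ : X -> \bar R;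
  J_ : Y -> \bar R;
  Phi : X -> Y -> R;
  mu : R;
  L : R;
  Lxx : R;
  Lyx : R;
  Lyy : R }.

Implicit Type P : spp.

Definition gradx P (x : X) (y : Y) : X -> R :=
  'd (fun x' => Phi P x' y : R^o) x.

Definition grady P (x : X) (y : Y) : Y -> R :=
  'd (fun y' => Phi P x y' : R^o) y.

(* +oo - +oo = -oo in \bar R, so saddle P x y = -oo whenever J_ P y = +oo, even
   for x outside the domain of g_ P. This forces saddle points into
   edom (g_ P) * edom (J_ P), and where (x, y) lies in that set, the pairs
   (x', y') outside of it contribute -oo to gap P x y. *)
Definition saddle P (x : X) (y : Y) : \bar R :=
  (f_ P x + g_ P x + (Phi P x y)%:E - J_ P y)%E.

Definition saddle_point P (x : X) (y : Y) : Prop :=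
  [/\ Xset P x, Yset P y &
    forall x' y', Xset P x' -> Yset P y' ->
      (saddle P x y' <= saddle P x y)%E /\ (saddle P x y <= saddle P x' y)%E].

Definition gap P (x : X) (y : Y) : \bar R :=
  ereal_sup [set d | exists x' y',
    [/\ Xset P x', Yset P y' & d = (saddle P x y' - saddle P x' y)%E]].

Record spp_assumptions P : Prop := SppAssumptions {
  Xset_nonempty : Xset P !=set0;
  Xset_closed : closed (Xset P);
  Xset_convex : convex_set (Xset P);
  Yset_nonempty : Yset P !=set0;
  Yset_closed : closed (Yset P);
  Yset_convex : convex_set (Yset P);
  f_ccp : ccp (f_ P);
  g_ccp : ccp (g_ P);
  J_ccp : ccp (J_ P);
  g_dom : edom (g_ P) `&` Xset P !=set0;
  J_dom : edom (J_ P) `&` Yset P !=set0;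
  f_differentiable : exists O : set X, [/\ open O, Xset P `<=` O &
    forall x, O x -> f_ P x \is a fin_num /\
      differentiable (fun w => fine (f_ P w) : R^o) x];
  L_ge0 : 0 <= L P;
  f_smooth : forall x x', Xset P x -> Xset P x' ->
    (dual_norm (fun w => grad (f_ P) x w - grad (f_ P) x' w)%R
      <= (L P * `|x - x'|)%:E)%E;
  f_strongly_convex : forall x x', Xset P x -> Xset P x' ->
    (f_ P x' + (grad (f_ P) x' (x - x'))%:E
      + (mu P / 2 * `|x - x'| ^+ 2)%:E <= f_ P x)%E;
  Phi_convex : forall y, Yset P y ->
    convex_function (Xset P) (fun x => Phi P x y);
  Phi_concave : forall x, Xset P x ->
    convex_function (Yset P) (fun y => - Phi P x y);
  Phi_differentiable : exists O : set (X * Y),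
    [/\ open O, Xset P `*` Yset P `<=` O &
    forall p, O p -> differentiable (fun q : X * Y => Phi P q.1 q.2 : R^o) p];
  Lxx_ge0 : 0 <= Lxx P;
  Lyx_ge0 : 0 <= Lyx P;
  Lyy_ge0 : 0 <= Lyy P;
  Phi_smooth_xx : forall x x' y, Xset P x -> Xset P x' -> Yset P y ->
    (dual_norm (fun w => gradx P x y w - gradx P x' y w)%R
      <= (Lxx P * `|x - x'|)%:E)%E;
  Phi_smooth_xy : forall x y y', Xset P x -> Yset P y -> Yset P y' ->
    (dual_norm (fun w => gradx P x y w - gradx P x y' w)%R
      <= (Lyx P * `|y - y'|)%:E)%E;
  Phi_smooth_yx : forall x x' y, Xset P x -> Xset P x' -> Yset P y ->
    (dual_norm (fun w => grady P x y w - grady P x' y w)%R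
      <= (Lyx P * `|x - x'|)%:E)%E;
  Phi_smooth_yy : forall x y y', Xset P x -> Yset P y -> Yset P y' ->
    (dual_norm (fun w => grady P x y w - grady P x y' w)%R
      <= (Lyy P * `|y - y'|)%:E)%E;
  saddle_point_exists : exists x y, saddle_point P x y }.

Section Algorithm.
Variables (P : spp) (hX : X -> \bar R) (hY : Y -> \bar R).

(* The sequences are indexed from 1, as in the pseudo-code; their values at
   index 0, and xt at index 1, play no role. *)
Definition subroutine_run (x0 : X) (r : R) (T : nat)
    (beta alpha tau theta : nat -> R)
    (x xb xt : nat -> X) (y yb : nat -> Y) (s : nat -> Y -> R) : Prop :=
  [/\ x 1%N = x0 /\ xb 1%N = x0,
      dgf_interior (Yset P) hY (y 1%N) /\ yb 1%N = y 1%N,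
      s 1%N = grady P (x 1%N) (y 1%N) &
      forall t : nat, (1 <= t < T)%N ->
        [/\ is_argmin (Yset P) ((edom hY)° `&` edom (J_ P))
              (fun v => J_ P v - (s t (v - y t))%:E
                        + (alpha t)^-1%:E * bregman hY v (y t))%E
              (y t.+1),
            xt t.+1 = (1 - beta t) *: xb t + beta t *: x t,
            is_argmin (Xset P)
              ((edom (rescaled hX (x 1%N) r))° `&` edom (g_ P))
              (fun u => g_ P u
                 + (gradx P (x t) (y t.+1) (u - x t)
                    + grad (f_ P) (xt t.+1) (u - x t))%:E
                 + (tau t)^-1%:E
                    * bregman (rescaled hX (x 1%N) r) u (x t))%E
              (x t.+1),
            s t.+1 = (fun w => (1 + theta t.+1) * grady P (x t.+1) (y t.+1) w
                               - theta t.+1 * grady P (x t) (y t) w) &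
            xb t.+1 = (1 - beta t) *: xb t + beta t *: x t.+1 /\
            yb t.+1 = (1 - beta t) *: yb t + beta t *: y t.+1]].

Definition subroutine_output (x0 : X) (r : R) (T : nat)
    (beta alpha tau theta : nat -> R) (xout : X) (yout : Y) : Prop :=
  exists x xb xt y yb s,
    [/\ subroutine_run x0 r T beta alpha tau theta x xb xt y yb s,
        xout = xb T & yout = yb T].

Definition OmegaX : R := fine (Omega' hX).
Definition OmegaY : R := fine (Omega (Yset P) hY).

(* If OmegaX = 0 or OmegaY = 0 (the feasible set is then a singleton), eta r and
   (eta r)^-1 are both 0. *)
Definition eta (r : R) : R := 4 / r * Num.sqrt (OmegaY / OmegaX).

Definition alpha_den (r : R) : R := 16 * ((eta r)^-1 * Lyx P + Lyy P).

Definition tau_den (r : R) (T : nat) : R :=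
  4 * L P + 2 * (Lxx P + eta r * Lyx P) * T%:R.

Definition log2 (a : R) : R := ln a / ln 2.

Definition num_stages (U eps : R) : nat :=
  `|Num.ceil (Num.max 0 (log2 (mu P * U ^+ 2 / (4 * eps))))%R|%N.+1.

(* R_1 = 2U, R_{k+1} = R_k / sqrt 2 *)
Definition stage_radius (U : R) (k : nat) : R :=
  iter k.-1 (fun r => r / Num.sqrt 2) (2 * U).

Definition stage_length (U : R) (k : nat) : nat :=
  let r := stage_radius U k in
  `|Num.ceil
      (Num.max 3
      (Num.max (64 * Num.sqrt (L P / mu P * OmegaX))
      (Num.max (1024 * (Lxx P / mu P) * OmegaX)
      (Num.max (4096 * Lyx P * (mu P * r)^-1 * Num.sqrt (OmegaX * OmegaY))
               (8192 * Lyy P * (mu P * r ^+ 2)^-1 * OmegaY)))))%R|%N.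

(* xs k and ys k are the inputs of stage k; ys 1 plays no role, since each
   run of the subroutine chooses its own initial y. *)
Definition restart_run (U eps : R) (x1 : X)
    (xs : nat -> X) (ys : nat -> Y) : Prop :=
  xs 1%N = x1 /\
  forall k : nat, (1 <= k <= num_stages U eps)%N ->
    let r := stage_radius U k in
    let T := stage_length U k in
    subroutine_output (xs k) r T
      (fun t => 2 / t.+1%:R)
      (fun=> (alpha_den r)^-1)
      (fun t => t%:R * (tau_den r T)^-1)
      (fun t => t.-1%:R / t%:R)
      (xs k.+1) (ys k.+1).

Definition stepsizes_well_defined (U eps : R) : Prop :=
  forall k : nat, (1 <= k <= num_stages U eps)%N ->
    0 < alpha_den (stage_radius U k) /\
    0 < tau_den (stage_radius U k) (stage_length U k).

Definition oracle_calls (U eps : R) : nat :=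
  (\sum_(1 <= k < (num_stages U eps).+1) stage_length U k)%N.

End Algorithm.
End SaddlePoint.

Arguments spp {R} X Y.

(* Main.v *)
Require Import Defs.
From mathcomp Require Import all_boot all_order all_algebra.
From mathcomp Require Import all_classical all_reals all_analysis.
From mathcomp Require Import ring lra.
Import Order.TTheory GRing.Theory Num.Theory.
Import numFieldNormedType.Exports.
Local Open Scope classical_set_scope.
Local Open Scope ring_scope.

(* Energy estimate for one run. With weights t, one accelerated primal-dual step
   telescopes: the descent lemma for f and for Phi(., y), the three-point
   inequalities of the two proximal steps and the extrapolated dual gradients give,
   for every u within the radius r of the center and every v,
     T(T-1)/2 (S(xbar,v) - S(u,ybar)) <= D(u,x0)/tau + (T-1) OmegaY/alpha,
   hence a gap of at most (21/1024) mu r^2 <= (3/128) mu r^2 for the prescribed T.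
   This bound is only local, since D(u,x0) <= r^2 OmegaX needs |u - x0| <= r. Strong
   convexity makes it global: if the saddle point is within r/2 of the center, it is
   within r/4 of xbar, and then moving from xbar towards any far competitor u first
   meets a point of the ball that is at least as good as u. Since r/4 is less than
   half of the next radius r/sqrt 2, the argument can be iterated over the stages. *)

(** The two step sizes behave differently. The primal one grows like t, so after multiplication by t
    the primal divergences carry one constant weight and telescope exactly; the dual one is
    constant, so its weights grow with t and each of the T - 1 steps costs one more [OmegaY]. This
    is why the dual side needs a bound over all of [Yset P], while the primal side only pays the
    divergence from the center.

    The other obstacle is that the points of a run need not lie where the data are finite or
    regular. A starting point may lie outside the domains of [g_ P] and [J_ P]; this is harmless
    because the first averaging weight is 1. The primal iterates are interior to the domain of the
    rescaled function of their own stage, which says nothing about the interior of the domain of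
    [hX], so strong convexity has to hold around every feasible center. Finally [eta] and its
    inverse may both be 0, so the coupling is handled through Young's inequality and not through
    their product. *)

Section Calculus.
Context {R : realType} {V : normedModType R}.
Implicit Types (A : set V) (F : V -> R) (u v d : V).

(** * Convexity and first-order inequalities along segments *)

Lemma convex_setP A u v (t : R) : convex_set A -> A u -> A v -> 0 <= t <= 1 ->
  A (t *: u + (1 - t) *: v).
Proof.
move=> cA Au Av /andP[t0 t1].
have := cA u v (Itv01 t0 t1); rewrite !inE => /(_ Au Av).
by [].
Qed.

Lemma convex_functionP A F u v (t : R) : convex_function A F -> A u -> A v ->
  0 <= t <= 1 -> F (t *: u + (1 - t) *: v) <= t * F u + (1 - t) * F v.
Proof.
move=> cF Au Av /andP[t0 t1].
have := cF (Itv01 t0 t1) u v; rewrite !inE => /(_ Au Av).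
by [].
Qed.

Lemma diff_cvg F u d : differentiable (F : V -> R^o) u ->
  (fun h : R => h^-1 * (F (u + h *: d) - F u)) @ 0^' --> ('d (F : V -> R^o) u d : R).
Proof.
move=> dF; rewrite -deriveE//.
have := @diff_derivable R V R^o F u d dF; rewrite /derivable /derive /=.
rewrite (_ : (fun h : R => h^-1 * _) = (fun h : R => h^-1 *: (F (h *: d + u) - F u))) //.
by apply/funext => h; rewrite (addrC u).
Qed.

(** Since the differential exists, one-sided quotients determine it. This serves both the tangent
    inequality of convex functions and the optimality of proximal steps, where only the points of a
    segment leaving [u] can be compared with [u]. *)
Lemma diff_ge F u d (a : R) : differentiable (F : V -> R^o) u ->
  (forall l, 0 < l <= 1 -> l * a <= F (u + l *: d) - F u) ->
  a <= 'd (F : V -> R^o) u d.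
Proof.
move=> dF aF; apply/ler_addgt0Pr => e e0.
have /cvgrPdist_le/(_ e e0) := diff_cvg F u d dF.
rewrite near_withinE => /nbhs_ballP[r /= r0 rF].
pose l := Num.min 1 (r / 2).
have l0 : 0 < l by rewrite lt_min ltr01 divr_gt0.
have l1 : l <= 1 by rewrite ge_min lexx.
have lr : l < r by rewrite gt_min [r / 2 < r]ltr_pdivrMr// ltr_pMr// ltr1n orbT.
have := rF l; rewrite /= /ball/= sub0r normrN gtr0_norm// => /(_ lr).
rewrite gt_eqF// => /(_ isT); rewrite ler_norml => /andP[+ _].
have : a <= l^-1 * (F (u + l *: d) - F u).
  by rewrite ler_pdivlMl//; apply: aF; rewrite l0 l1.
lra.
Qed.

Lemma convex_above_tangent A F u v : convex_function A F -> A u -> A v ->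
  differentiable (F : V -> R^o) u ->
  F u + 'd (F : V -> R^o) u (v - u) <= F v.
Proof.
move=> cF Au Av dF.
have dNF : differentiable (- F : V -> R^o) u by exact: differentiableN.
suff : F u - F v <= 'd (- F : V -> R^o) u (v - u).
  by rewrite diffN// -[(- _) _]/(- ('d (F : V -> R^o) u (v - u) : R)); lra.
apply: (diff_ge (- F)) => // l /andP[l0 l1].
have := convex_functionP A F v u l cF Av Au; rewrite (ltW l0) l1 => /(_ isT).
have -> : l *: v + (1 - l) *: u = u + l *: (v - u).
  by rewrite scalerBl scalerBr scale1r addrCA.
rewrite -[(- F) u]/(- F u) -[(- F) (_ + _)]/(- F _); lra.
Qed.

(** The mean value theorem replaces the usual integral: [b] is chosen so that the derivative of
    [phi] at s is at most C s |d|^2 - 2 s b = 0, whence phi 1 <= phi 0. *)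
Lemma descent A F (C : R) u v : convex_set A ->
  (forall w, A w -> differentiable (F : V -> R^o) w) ->
  (forall w w' d, A w -> A w' ->
    `|'d (F : V -> R^o) w d - 'd (F : V -> R^o) w' d| <= C * `|w - w'| * `|d|) ->
  A u -> A v ->
  F v <= F u + 'd (F : V -> R^o) u (v - u) + C / 2 * `|v - u| ^+ 2.
Proof.
move=> cA dF lip Au Av; set d := v - u.
have seg (s : R) : 0 <= s <= 1 -> A (u + s *: d).
  move=> s01; rewrite (_ : u + _ = s *: v + (1 - s) *: u).
    exact: convex_setP.
  by rewrite scalerBl scalerBr scale1r addrCA.
pose a := 'd (F : V -> R^o) u d; pose b := C / 2 * `|d| ^+ 2.
pose phi (s : R) : R^o := F (u + s *: d) - s * a - s ^+ 2 * b.
have dline (s : R) : is_derive s (1 : R) (fun s : R => u + s *: d) d.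
  have dl : is_diff s (cst u + ( *:%R^~ d : R -> V)) (0 + *:%R^~ d).
    by apply: is_diffD.
  split; first exact/diff_derivable.
  by rewrite deriveE// diff_val/= /GRing.add/= add0r scale1r.
have dphi (s : R) : 0 <= s <= 1 ->
    is_derive s 1 phi ('d (F : V -> R^o) (u + s *: d) d - a - s *+ 2 * b).
  move=> s01.
  have dFs := dF _ (seg s s01).
  have dFl : is_derive s 1 (fun s : R => F (u + s *: d) : R^o)
      ('d (F : V -> R^o) (u + s *: d) d).
    have dl : differentiable (fun s : R => u + s *: d) s.
      exact/derivable1_diffP.
    split; first by apply/derivable1_diffP; exact: (differentiable_comp dl).
    rewrite deriveE; last exact: (differentiable_comp dl).
    rewrite (diff_comp dl)//=; congr ('d _ _ _).
    by rewrite -deriveE//; have [] := dline s.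
  have -> : phi = (fun s : R => F (u + s *: d) : R^o) - (a \*: (id : R -> R^o))
      - (b \*: (id : R -> R^o) ^+ 2).
    apply/funext => r; rewrite /phi; congr (_ - _ - _); first by rewrite mulrC.
    by rewrite mulrC.
  apply: is_derive_eq.
  rewrite /GRing.scale /=; ring.
have [c c01] : exists2 c : R, c \in `]0, 1[%R &
    phi 1 - phi 0 = ('d (F : V -> R^o) (u + c *: d) d - a - c *+ 2 * b) * (1 - 0).
  apply: (@MVT R phi (fun c => 'd (F : V -> R^o) (u + c *: d) d - a - c *+ 2 * b)).
  - exact: ltr01.
  - by move=> s; rewrite in_itv/= => /andP[/ltW s0 /ltW s1]; apply: dphi; rewrite s0.
  - apply: derivable_within_continuous => s; rewrite in_itv/= => s01.
    by have [] := dphi s s01.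
rewrite /phi subr0 mulr1 expr1n !mul1r expr0n /= !mul0r !subr0 scale1r scale0r addr0.
move: c01; rewrite in_itv/= => /andP[c0 c1].
have c01 : 0 <= c <= 1 by rewrite (ltW c0) (ltW c1).
have := lip _ _ d (seg _ c01) Au.
rewrite (_ : u + c *: d - u = c *: d); last by rewrite addrAC subrr add0r.
rewrite normrZ gtr0_norm// ler_norml => /andP[_].
have -> : u + d = v by rewrite /d addrC subrK.
rewrite -/a /b; lra.
Qed.

End Calculus.

(** * Bregman divergences and the proximal three-point inequality *)

Section Bregman.
Context {R : realType} {V : normedModType R}.
Implicit Types (A : set V) (h G : V -> \bar R) (c u v w p : V) (r k : R).

Lemma dual_norm_bound (phi : V -> R) (C : R) :
  (forall (a : R) v, phi (a *: v) = a * phi v) ->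
  (dual_norm phi <= C%:E)%E -> forall v, `|phi v| <= C * `|v|.
Proof.
move=> phiZ phiC v; have [->|v0] := eqVneq v 0.
  by rewrite -(scale0r 0) phiZ mul0r normr0 scale0r normr0 mulr0.
have nv : 0 < `|v| by rewrite normr_gt0.
have : (`|phi (`|v|^-1 *: v)|%:E <= C%:E)%E.
  apply: le_trans phiC; apply: ereal_sup_ubound; exists (`|v|^-1 *: v) => //=.
  by rewrite normrZ normfV normr_id mulVf ?gt_eqF.
by rewrite lee_fin phiZ normrM normfV normr_id ler_pdivrMl// mulrC.
Qed.

(** This pulls an arbitrary center into the interior of the domain of a distance generating
    function. *)
Lemma nbhs_segment A u v : nbhs u A ->
  exists2 t : R, 0 < t <= 1 & A (t *: v + (1 - t) *: u).
Proof.
move=> /nbhs_ballP[e /= e0 eA]; set d := v - u.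
have d1 : 0 < `|d| + 1 by rewrite ltr_wpDl.
pose t := Num.min 1 (e / (`|d| + 1)).
have t0 : 0 < t by rewrite lt_min ltr01 divr_gt0.
exists t; first by rewrite t0 ge_min lexx.
have -> : t *: v + (1 - t) *: u = u + t *: d.
  by rewrite scalerBl scalerBr scale1r addrCA.
apply: eA; rewrite -ball_normE /ball_/= opprD addrA subrr sub0r normrN normrZ gtr0_norm//.
apply: (@le_lt_trans _ _ (e / (`|d| + 1) * `|d|)).
  by rewrite ler_wpM2r// ge_min lexx orbT.
by rewrite mulrAC ltr_pdivrMr// ltr_pM2l// ltrDl.
Qed.

(** A real-valued form open to linear arithmetic; it is meaningful only where [h u] and [h v] are
    finite. *)
Definition rbregman h u v : R := fine (h u) - fine (h v) - grad h v (u - v).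

Lemma bregmanE h u v : h u \is a fin_num -> h v \is a fin_num ->
  bregman h u v = (rbregman h u v)%:E.
Proof. by move=> hu hv; rewrite /bregman -(fineK hu) -(fineK hv). Qed.

Lemma edom_fin h u : (-oo < h u)%E -> edom h u -> h u \is a fin_num.
Proof. by rewrite /edom/= fin_numElt => -> ->. Qed.

Lemma ccp_fin h u : ccp h -> edom h u -> h u \is a fin_num.
Proof. by move=> ch; apply: edom_fin; exact: ccp_gt_ninfty. Qed.

Lemma ccp_fine_convex h u v (t : R) : ccp h -> edom h u -> edom h v -> 0 <= t <= 1 ->
  edom h (t *: u + (1 - t) *: v) /\
  fine (h (t *: u + (1 - t) *: v)) <= t * fine (h u) + (1 - t) * fine (h v).
Proof.
move=> ch hu hv t01; have := ccp_convex ch u v t01.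
rewrite -(fineK (ccp_fin h u ch hu)) -(fineK (ccp_fin h v ch hv)) -!EFinM -EFinD => le_h.
have hw : edom h (t *: u + (1 - t) *: v) by apply: le_lt_trans le_h _; rewrite ltry.
split=> //; rewrite -lee_fin (le_trans _ le_h)//.
by rewrite fineK//; exact: ccp_fin.
Qed.

(* Compare [u] with the points of the segment [u, p] and let these tend to [u]. *)
Lemma prox_three_points A G h (l : V -> R) k u v p :
  convex_set A -> ccp G -> (forall w, -oo < h w)%E ->
  (forall w w' (t : R), edom h w -> edom h w' -> 0 <= t <= 1 ->
    edom h (t *: w + (1 - t) *: w')) ->
  (forall w w' (t : R), l (t *: w + (1 - t) *: w') = t * l w + (1 - t) * l w') ->
  0 < k -> edom h v -> (edom h) u -> edom G u ->
  differentiable (fun w => fine (h w) : R^o) u ->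
  minimizer A (fun q => G q + (l q)%:E + k%:E * bregman h q v)%E u ->
  A p -> edom G p -> edom h p ->
  fine (G u) + l u <=
    fine (G p) + l p + k * (rbregman h p v - rbregman h p u - rbregman h u v).
Proof.
move=> cA cG hny hcvx l_aff k0 hv hu Gu dhu [Au umin] Ap Gp hp.
have hfin w : edom h w -> h w \is a fin_num by exact: edom_fin.
(* By the three-point identity the bracket of divergences is [grad h u (p - u) - grad h v (p - u)],
   so the claim is a lower bound on the slope of [h] at [u] towards [p]; [a] is that bound. *)
pose a := k^-1 * (fine (G u) + l u - fine (G p) - l p) + grad h v (p - u).
suff /(ler_wpM2l (ltW k0)) : a <= grad h u (p - u).
  rewrite /a mulrDr mulVKf ?gt_eqF//.
  rewrite (_ : rbregman h p v - _ - _ = grad h u (p - u) - grad h v (p - u)).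
    lra.
  have -> : grad h v (p - u) = grad h v (p - v) - grad h v (u - v).
    by rewrite /grad -linearB /= opprB addrA subrK.
  by rewrite /rbregman; ring.
apply: diff_ge => // t /andP[t0 t1].
have t01 : 0 <= t <= 1 by rewrite (ltW t0).
have -> : u + t *: (p - u) = t *: p + (1 - t) *: u.
  by rewrite scalerBl scalerBr scale1r addrCA.
have [Gw leG] := ccp_fine_convex G p u t cG Gp Gu t01.
have := umin _ (convex_setP A p u t cA Ap Au t01).
have hw := hcvx p u t hp hu t01.
move: Gw leG hw; set w := _ + _ => Gw leG hw.
rewrite !bregmanE ?hfin// -(fineK (ccp_fin G u cG Gu)) -(fineK (ccp_fin G w cG Gw)).
rewrite -!EFinM -!EFinD lee_fin /rbregman.
have -> : grad h v (w - v) = grad h v (u - v) + t * grad h v (p - u).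
  rewrite /grad -linearZ -linearD /=; congr ('d _ _ _).
  by rewrite /w scalerBl scalerBr scale1r addrCA addrAC.
rewrite {1}/w l_aff => le_w.
rewrite -(ler_pM2l k0).
have -> : k * (t * a) =
    t * (fine (G u) + l u - fine (G p) - l p) + k * (t * grad h v (p - u)).
  by rewrite /a; field; rewrite gt_eqF.
move: le_w leG; lra.
Qed.

End Bregman.

(** * Rescaled distance generating functions *)

Section Rescaled.
Context {R : realType} {V : normedModType R}.
Implicit Types (A : set V) (h : V -> \bar R) (c u v w : V) (r : R).

Lemma edom_rescaled h c r u : 0 < r ->
  edom (rescaled h c r) u = edom h (r^-1 *: (u - c)).
Proof.
move=> r0; rewrite /edom /rescaled /=.
have r2 : (0 < (r ^+ 2)%:E)%E by rewrite lte_fin exprn_gt0.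
case: (h _) => [s| |] //=; first by rewrite -EFinM !ltry.
- by rewrite gt0_muley.
- by rewrite gt0_muleNy// !ltNyr.
Qed.

Lemma fine_rescaled h c r u : 0 < r ->
  fine (rescaled h c r u) = r ^+ 2 * fine (h (r^-1 *: (u - c))).
Proof.
move=> r0; rewrite /rescaled.
have r2 : (0 < (r ^+ 2)%:E)%E by rewrite lte_fin exprn_gt0.
case: (h _) => [s| |] //=.
- by rewrite gt0_muley// mulr0.
- by rewrite gt0_muleNy// mulr0.
Qed.

Lemma rescaled_gt_ninfty h c r u : 0 < r -> (forall v, -oo < h v)%E ->
  (-oo < rescaled h c r u)%E.
Proof.
move=> r0 hny; rewrite /rescaled; have := hny (r^-1 *: (u - c)).
case: (h _) => [s| |] //= _; first by rewrite -EFinM ltNyr.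
by rewrite gt0_muley// lte_fin exprn_gt0.
Qed.

Lemma affine_scale c r u v (t : R) : r^-1 *: (t *: u + (1 - t) *: v - c) =
  t *: (r^-1 *: (u - c)) + (1 - t) *: (r^-1 *: (v - c)).
Proof.
rewrite !scalerA [t * _]mulrC [(1 - t) * _]mulrC -!scalerA -scalerDr; congr (_ *: _).
rewrite !scalerBr addrACA -opprD -scalerDl [t + _]addrC subrK scale1r //.
Qed.

Lemma edom_rescaled_convex h c r u v (t : R) : 0 < r -> ccp h ->
  edom (rescaled h c r) u -> edom (rescaled h c r) v -> 0 <= t <= 1 ->
  edom (rescaled h c r) (t *: u + (1 - t) *: v).
Proof.
move=> r0 ch; rewrite !edom_rescaled// affine_scale => hu hv t01.
by have [] := ccp_fine_convex h _ _ t ch hu hv t01.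
Qed.

Lemma continuous_affine c r : continuous (fun u => r^-1 *: (u - c)).
Proof.
move=> u; apply: (@continuousZl_tmp _ _ _ (fun u => u - c) _ u).
by apply: continuousB; [exact: cvg_id|exact: cvg_cst].
Qed.

Lemma interior_rescaled h c r u : 0 < r ->
  (edom (rescaled h c r))° u <-> (edom h)° (r^-1 *: (u - c)).
Proof.
move=> r0; have -> : edom (rescaled h c r) = (fun u => r^-1 *: (u - c)) @^-1` edom h.
  by apply/funext => w; rewrite edom_rescaled.
rewrite /interior /=; split => H; last exact: continuous_affine.
(* The inverse affine map, written in the same shape so that [continuous_affine] applies to it
   too. *)
pose g w : V := r^-1^-1 *: (w - - (r^-1 *: c)).
have gK w : r^-1 *: (g w - c) = w.
  by rewrite /g opprK invrK scalerBr scalerA mulVf ?gt_eqF// scale1r addrK.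
have gu : g (r^-1 *: (u - c)) = u.
  rewrite /g opprK -scalerDr addrNK invrK scalerA divff ?gt_eqF// scale1r //.
have : g w @[w --> r^-1 *: (u - c)] --> g (r^-1 *: (u - c)).
  exact: continuous_affine.
rewrite gu => /(_ _ H) Hg.
have {}Hg : nbhs (r^-1 *: (u - c)) (fun w => edom h (r^-1 *: (g w - c))) := Hg.
by apply: filterS Hg => w; rewrite gK.
Qed.

Lemma rescaled_grad h c r v : 0 < r ->
  differentiable (fun w => fine (h w) : R^o) (r^-1 *: (v - c)) ->
  differentiable (fun w => fine (rescaled h c r w) : R^o) v /\
  forall w, grad (rescaled h c r) v w = r ^+ 2 * grad h (r^-1 *: (v - c)) (r^-1 *: w).
Proof.
move=> r0 dh.
have dT : is_diff v (fun u : V => r^-1 *: (u - c)) (fun u => r^-1 *: u).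
  have dTc : is_diff v ((id : V -> V) - cst c) (id - 0) by apply: is_diffB.
  have := @is_diffZ _ _ _ _ _ r^-1 _ dTc.
  by rewrite subr0.
have dhT : differentiable (fun u => fine (h (r^-1 *: (u - c))) : R^o) v.
  exact: (@differentiable_comp _ _ _ _ (fun u : V => r^-1 *: (u - c))
    (fun w => fine (h w) : R^o) v).
have Eh : (fun w => fine (rescaled h c r w) : R^o) =
    r ^+ 2 *: (fun w => fine (h (r^-1 *: (w - c))) : R^o).
  by apply/funext => w; rewrite fine_rescaled.
split=> [|w]; first by rewrite Eh; exact: differentiableZ.
rewrite /grad Eh diffZ// (_ : (fun w => fine (h (r^-1 *: (w - c))) : R^o) =
    (fun w => fine (h w) : R^o) \o (fun w => r^-1 *: (w - c)))//.
rewrite -[LHS]/(r ^+ 2 * ('d _ v w : R)) diff_comp//=.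
by rewrite (@diff_val _ _ _ _ _ _ _ dT).
Qed.

Lemma rbregman_rescaled h c r u v : 0 < r ->
  differentiable (fun w => fine (h w) : R^o) (r^-1 *: (v - c)) ->
  rbregman (rescaled h c r) u v =
    r ^+ 2 * rbregman h (r^-1 *: (u - c)) (r^-1 *: (v - c)).
Proof.
move=> r0 dh; rewrite /rbregman !fine_rescaled// (rescaled_grad h c r v r0 dh).2.
by rewrite -!mulrBr -scalerBr opprB addrA subrK.
Qed.

(* The hypothesis only covers centers in the interior of the domain of [h]; for
   an arbitrary center [c] of [A], shrink the triple [c, u, v] towards [c0]. *)
Lemma rescaled_strong_convexity A h c0 c r u v :
  convex_set A -> ccp h -> essentially_smooth h ->
  rescaled_strongly_convex A h -> dgf_interior A h c0 ->
  A c -> 0 < r -> A u -> edom (rescaled h c r) u -> dgf_interior A (rescaled h c r) v ->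
  2^-1 * `|u - v| ^+ 2 <= rbregman (rescaled h c r) u v.
Proof.
move=> cA ch sh hsc [Ac0 hc0] Ac r0 Au hu [Av hv].
have [t /andP[t0 t1] hts] := nbhs_segment _ _ c (nbhs_interior hc0).
have t01 : 0 <= t <= 1 by rewrite (ltW t0).
pose s w := t *: w + (1 - t) *: c0.
have tr : 0 < t * r by rewrite mulr_gt0.
(* Contracting by [t] and using the radius [t * r] leaves the argument of [h] unchanged, so both
   sides of the inequality only pick up the factor t^2. *)
have sE w : (t * r)^-1 *: (s w - s c) = r^-1 *: (w - c).
  rewrite /s opprD addrACA subrr addr0 -scalerBr scalerA invfM mulrAC mulVf ?gt_eqF//.
  by rewrite mul1r.
have As w : A w -> A (s w) by move=> Aw; exact: convex_setP.
have hv' := hv; rewrite interior_rescaled// in hv'.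
have := hsc (s c) (t * r) (conj (As _ Ac) hts) tr (s u) (s v).
have hsu : edom (rescaled h (s c) (t * r)) (s u).
  by rewrite edom_rescaled// sE -edom_rescaled.
have hsv : (edom (rescaled h (s c) (t * r)))° (s v).
  by rewrite interior_rescaled// sE.
move=> /(_ (conj (As _ Au) hsu) (conj (As _ Av) hsv)).
have dh := es_differentiable sh hv'.
have fin w : edom (rescaled h (s c) (t * r)) w ->
    rescaled h (s c) (t * r) w \is a fin_num.
  by apply: edom_fin; apply: rescaled_gt_ninfty => // w'; exact: ccp_gt_ninfty.
rewrite bregmanE ?fin//; last exact: (interior_subset hsv).
rewrite lee_fin !rbregman_rescaled ?sE// (_ : s u - s v = t *: (u - v)); last first.
  by rewrite /s opprD addrACA subrr addr0 scalerBr.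
rewrite normrZ gtr0_norm// !exprMn mulrCA -[leRHS]mulrA.
by rewrite ler_pM2l// exprn_gt0.
Qed.

End Rescaled.

(** * Smoothness and convexity of the saddle function, and one averaging step *)

Section Problem.
Context {R : realType} {X Y : normedModType R}.
Variables (P : spp X Y) (hP : spp_assumptions P).

Definition rsaddle (x : X) (y : Y) : R :=
  fine (f_ P x) + fine (g_ P x) + Phi P x y - fine (J_ P y).

Lemma f_fin x : Xset P x -> f_ P x \is a fin_num.
Proof.
move=> Xx; have [W [_ XO fO]] := f_differentiable hP.
by have [] := fO x (XO x Xx).
Qed.

Lemma f_diff x : Xset P x -> differentiable (fun w => fine (f_ P w) : R^o) x.
Proof.
move=> Xx; have [W [_ XO fO]] := f_differentiable hP.
by have [] := fO x (XO x Xx).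
Qed.

Lemma Phi_diffx x y : Xset P x -> Yset P y ->
  differentiable (fun w => Phi P w y : R^o) x.
Proof.
move=> Xx Yy; have [W [_ XO PO]] := Phi_differentiable hP.
have dP := PO (x, y) (XO (x, y) (conj Xx Yy)).
have dp : differentiable (fun w : X => (w, y)) x by exact: differentiable_pair.
exact: (@differentiable_comp _ _ _ _ (fun w : X => (w, y))
  (fun q : X * Y => Phi P q.1 q.2 : R^o) x).
Qed.

Lemma Phi_diffy x y : Xset P x -> Yset P y ->
  differentiable (fun w => Phi P x w : R^o) y.
Proof.
move=> Xx Yy; have [W [_ XO PO]] := Phi_differentiable hP.
have dP := PO (x, y) (XO (x, y) (conj Xx Yy)).
have dp : differentiable (fun w : Y => (x, w)) y by exact: differentiable_pair.
exact: (@differentiable_comp _ _ _ _ (fun w : Y => (x, w))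
  (fun q : X * Y => Phi P q.1 q.2 : R^o) y).
Qed.

Lemma gradfZ x (a : R) v : grad (f_ P) x (a *: v) = a * grad (f_ P) x v.
Proof. by rewrite /grad linearZ. Qed.

Lemma gradxZ x y (a : R) v : gradx P x y (a *: v) = a * gradx P x y v.
Proof. by rewrite /gradx linearZ. Qed.

Lemma gradyZ x y (a : R) v : grady P x y (a *: v) = a * grady P x y v.
Proof. by rewrite /grady linearZ. Qed.

Lemma gradfP x (a : R) v w :
  grad (f_ P) x (a *: v + w) = a * grad (f_ P) x v + grad (f_ P) x w.
Proof. by rewrite /grad linearP. Qed.

Lemma gradxP x y (a : R) v w :
  gradx P x y (a *: v + w) = a * gradx P x y v + gradx P x y w.
Proof. by rewrite /gradx linearP. Qed.

Lemma gradyP x y (a : R) v w :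
  grady P x y (a *: v + w) = a * grady P x y v + grady P x y w.
Proof. by rewrite /grady linearP. Qed.

Lemma grady_lip x x' y y' d : Xset P x -> Xset P x' -> Yset P y -> Yset P y' ->
  `|grady P x y d - grady P x' y' d| <= (Lyx P * `|x - x'| + Lyy P * `|y - y'|) * `|d|.
Proof.
move=> Xx Xx' Yy Yy'.
have -> : grady P x y d - grady P x' y' d =
    (grady P x y d - grady P x' y d) + (grady P x' y d - grady P x' y' d).
  by rewrite addrA subrK.
rewrite mulrDl (le_trans (ler_normD _ _))// lerD//.
- apply: (dual_norm_bound (fun w => grady P x y w - grady P x' y w)).
    by move=> a v; rewrite !gradyZ mulrBr.
  exact: (Phi_smooth_yx hP).
- apply: (dual_norm_bound (fun w => grady P x' y w - grady P x' y' w)).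
    by move=> a v; rewrite !gradyZ mulrBr.
  exact: (Phi_smooth_yy hP).
Qed.

Lemma Phi_descent x x' y : Xset P x -> Xset P x' -> Yset P y ->
  Phi P x' y <= Phi P x y + gradx P x y (x' - x) + Lxx P / 2 * `|x' - x| ^+ 2.
Proof.
move=> Xx Xx' Yy.
apply: (descent (Xset P) (fun w => Phi P w y)) => //; first exact: Xset_convex.
  by move=> w Xw; exact: Phi_diffx.
move=> w w' d Xw Xw'.
apply: (dual_norm_bound (fun d => gradx P w y d - gradx P w' y d)).
  by move=> a v; rewrite !gradxZ mulrBr.
exact: (Phi_smooth_xx hP).
Qed.

Lemma Phi_tangentx x x' y : Xset P x -> Xset P x' -> Yset P y ->
  Phi P x y + gradx P x y (x' - x) <= Phi P x' y.
Proof.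
move=> Xx Xx' Yy.
apply: (convex_above_tangent (Xset P) (fun w => Phi P w y)) => //.
  exact: (Phi_convex hP).
exact: Phi_diffx.
Qed.

Lemma Phi_tangenty x y y' : Xset P x -> Yset P y -> Yset P y' ->
  Phi P x y' <= Phi P x y + grady P x y (y' - y).
Proof.
move=> Xx Yy Yy'.
have dPhi := Phi_diffy x y Xx Yy.
have := convex_above_tangent (Yset P) (fun w => - Phi P x w) y y'
  (Phi_concave hP Xx) Yy Yy' (differentiableN dPhi).
rewrite (_ : (fun w => - Phi P x w : R^o) = - (fun w => Phi P x w : R^o))//.
rewrite diffN// -[(- _) _]/(- (grady P x y (y' - y))); lra.
Qed.

Lemma f_descent x x' : Xset P x -> Xset P x' ->
  fine (f_ P x') <= fine (f_ P x) + grad (f_ P) x (x' - x) + L P / 2 * `|x' - x| ^+ 2.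
Proof.
move=> Xx Xx'.
apply: (descent (Xset P) (fun w => fine (f_ P w))) => //; first exact: Xset_convex.
  by move=> w Xw; exact: f_diff.
move=> w w' d Xw Xw'.
apply: (dual_norm_bound (fun d => grad (f_ P) w d - grad (f_ P) w' d)).
  by move=> a v; rewrite !gradfZ mulrBr.
exact: (f_smooth hP).
Qed.

Lemma f_strong x x' : Xset P x -> Xset P x' ->
  fine (f_ P x) + grad (f_ P) x (x' - x) + mu P / 2 * `|x' - x| ^+ 2 <= fine (f_ P x').
Proof.
move=> Xx Xx'; have := f_strongly_convex hP Xx' Xx.
by rewrite -(fineK (f_fin x Xx)) -(fineK (f_fin x' Xx')).
Qed.

(** Both endpoints are bounded below from [z] by first-order strong convexity. With weights t and 1
    - t the slopes cancel, and t (1 - t)^2 + (1 - t) t^2 = t (1 - t). *)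
Lemma f_strong_segment x x' (t : R) : Xset P x -> Xset P x' -> 0 <= t <= 1 ->
  fine (f_ P (t *: x + (1 - t) *: x')) <=
    t * fine (f_ P x) + (1 - t) * fine (f_ P x') - mu P / 2 * (t * (1 - t)) * `|x - x'| ^+ 2.
Proof.
move=> Xx Xx' t01; have Xz := convex_setP _ _ _ t (Xset_convex hP) Xx Xx' t01.
have := f_strong _ _ Xz Xx; have := f_strong _ _ Xz Xx'.
set z := t *: x + (1 - t) *: x'.
have -> : x - z = (1 - t) *: (x - x').
  by rewrite /z opprD addrA -{1}(scale1r x) -scalerBl scalerBr.
have -> : x' - z = (- t) *: (x - x').
  rewrite /z scalerBl scale1r scaleNr scalerBr opprD !opprB addrCA [x' + _]addrC.
  by rewrite subrK addrC.
rewrite !normrZ !gradfZ normrN; case/andP: t01 => t0 t1.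
rewrite !ger0_norm ?subr_ge0// !exprMn.
set D := `|x - x'| ^+ 2; set gz := grad _ _ _; set fz := fine (f_ P z).
move=> /(ler_wpM2l (_ : 0 <= 1 - t)); rewrite subr_ge0 => /(_ t1) H1.
move=> /(ler_wpM2l t0) H2.
rewrite -subr_ge0 (_ : _ - fz = (((1 - t) * fine (f_ P x') -
   (1 - t) * (fz + - t * gz + mu P / 2 * (t ^+ 2 * D))) +
   (t * fine (f_ P x) - t * (fz + (1 - t) * gz + mu P / 2 * ((1 - t) ^+ 2 * D))))).
  by rewrite addr_ge0 ?subr_ge0.
ring.
Qed.

(** The new average differs from the point [m] carrying the gradient by b (q - p), so the descent
    lemma leaves only b^2 in front of [L P]: this is the source of acceleration. Tangents at [m]
    towards [u] and [x], weighted 1 - b and b, supply the rest. *)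
Lemma f_averaging_step u p q x (b : R) :
  0 <= b <= 1 -> Xset P u -> Xset P p -> Xset P q -> Xset P x -> 0 <= mu P ->
  fine (f_ P ((1 - b) *: u + b *: q)) <= (1 - b) * fine (f_ P u) +
    b * (fine (f_ P x) + grad (f_ P) ((1 - b) *: u + b *: p) (q - x)) +
    L P / 2 * (b ^+ 2 * `|q - p| ^+ 2).
Proof.
move=> b01 Xu Xp Xq Xx mu0.
have cX := Xset_convex hP.
have Xm w : Xset P w -> Xset P ((1 - b) *: u + b *: w).
  by move=> Xw; rewrite addrC; exact: convex_setP.
have := f_descent _ _ (Xm p Xp) (Xm q Xq).
have tangent w : Xset P w -> fine (f_ P ((1 - b) *: u + b *: p)) +
    grad (f_ P) ((1 - b) *: u + b *: p) (w - ((1 - b) *: u + b *: p)) <= fine (f_ P w).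
  move=> Xw; apply: le_trans (f_strong _ _ (Xm p Xp) Xw).
  by rewrite lerDl mulr_ge0// divr_ge0.
have := tangent u Xu; have := tangent x Xx.
set m := (1 - b) *: u + b *: p; set gm := grad _ _.
have -> : (1 - b) *: u + b *: q - m = b *: (q - p).
  by rewrite /m opprD addrACA subrr add0r scalerBr.
have gmD v w : gm (v + w) = gm v + gm w by rewrite /gm /grad linearD.
have gmN v : gm (- v) = - gm v by rewrite /gm /grad linearN.
have gmZ (a : R) v : gm (a *: v) = a * gm v by rewrite /gm gradfZ.
rewrite normrZ exprMn !gmD !gmN !gmZ gmD gmN.
have -> : gm m = (1 - b) * gm u + b * gm p by rewrite gmD !gmZ.
case/andP: b01 => b0 b1; rewrite (ger0_norm b0).
move=> /(ler_wpM2l b0) Hx.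
move=> /(ler_wpM2l (_ : 0 <= 1 - b)); rewrite subr_ge0 => /(_ b1) Hu.
lra.
Qed.

Lemma rsaddleE x y : Xset P x -> edom (g_ P) x -> edom (J_ P) y ->
  saddle P x y = (rsaddle x y)%:E.
Proof.
move=> Xx gx Jy; rewrite /saddle /rsaddle.
rewrite -(fineK (f_fin x Xx)) -(fineK (ccp_fin _ _ (g_ccp hP) gx)).
by rewrite -(fineK (ccp_fin _ _ (J_ccp hP) Jy)).
Qed.

Lemma ccp_average (V : normedModType R) (h : V -> \bar R) u v (b : R) : ccp h ->
  edom h v -> 0 <= b <= 1 -> (b != 1 -> edom h u) ->
  edom h ((1 - b) *: u + b *: v) /\
  fine (h ((1 - b) *: u + b *: v)) <= (1 - b) * fine (h u) + b * fine (h v).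
Proof.
move=> ch hv b01 hu; have [->|/hu {}hu] := eqVneq b 1.
  by rewrite subrr scale0r add0r scale1r mul0r add0r mul1r.
by rewrite addrC [leRHS]addrC; exact: ccp_fine_convex.
Qed.

(* The coefficient of the previous averages vanishes when [b = 1], so at the first
   step these need not lie in the domains of [g] and [J]. *)
Lemma gap_averaging_step ub vb p q w x y (b : R) :
  0 <= b <= 1 -> 0 <= mu P ->
  Xset P ub -> Yset P vb -> Xset P p -> Xset P q -> Yset P w ->
  Xset P x -> Yset P y ->
  edom (g_ P) q -> edom (J_ P) w ->
  (b != 1 -> edom (g_ P) ub /\ edom (J_ P) vb) ->
  rsaddle ((1 - b) *: ub + b *: q) y - rsaddle x ((1 - b) *: vb + b *: w) <=
    (1 - b) * (rsaddle ub y - rsaddle x vb) +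
    b * (fine (g_ P q) - fine (g_ P x) + fine (J_ P w) - fine (J_ P y)
      + grad (f_ P) ((1 - b) *: ub + b *: p) (q - x)
      + gradx P p w (q - x) + Lxx P / 2 * `|q - p| ^+ 2
      + grady P q w (y - w))
    + L P / 2 * (b ^+ 2 * `|q - p| ^+ 2).
Proof.
move=> b01 mu0 Xu Yv Xp Xq Yw Xx Yy gq Jw dom1; rewrite /rsaddle.
have := f_averaging_step _ _ _ _ b b01 Xu Xp Xq Xx mu0.
have [|_] := ccp_average _ _ ub q b (g_ccp hP) gq b01; first by move=> /dom1[].
have [|_] := ccp_average _ _ vb w b (J_ccp hP) Jw b01; first by move=> /dom1[].
have := convex_functionP _ _ q ub b (Phi_convex hP Yy) Xq Xu b01.
have := convex_functionP _ _ w vb b (Phi_concave hP Xx) Yw Yv b01.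
rewrite [b *: w + _]addrC [b *: q + _]addrC => H1 H2 H3 H4 H5.
have /andP[b0 b1] := b01.
have := Phi_tangenty _ _ _ Xq Yw Yy => /(ler_wpM2l b0) H6.
have := Phi_descent _ _ _ Xp Xq Yw => /(ler_wpM2l b0) H7.
have := Phi_tangentx _ _ _ Xp Xx Yw => /(ler_wpM2l b0).
have -> : gradx P p w (x - p) = gradx P p w (q - p) - gradx P p w (q - x).
  by rewrite /gradx -linearB /= opprB [q - p + _]addrC addrA subrK.
move=> H8; lra.
Qed.

End Problem.

(** * Consequences of finite [Omega] and [Omega'] *)

Section OmegaBounds.
Context {R : realType} {V : normedModType R}.
Implicit Types (A : set V) (h : V -> \bar R).

Lemma ball_interior h : [set x : V | `|x| <= 1] `<=` edom h -> (edom h)° 0.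
Proof.
move=> bh; apply/nbhs_ballP; exists 1 => //= z; rewrite -ball_normE /ball_/= sub0r normrN.
by move=> /ltW /bh.
Qed.

Lemma dgf_interior_edom A h u : dgf_interior A h u -> edom h u.
Proof. by case=> _; exact: interior_subset. Qed.

(** A finite [Omega] forces every feasible point into the domain, since an infinite [h u] would make
    the divergence infinite. *)
Lemma rbregman_le_Omega A h u v : ccp h -> (Omega A h < +oo)%E ->
  A u -> dgf_interior A h v ->
  edom h u /\ rbregman h u v <= fine (Omega A h).
Proof.
move=> ch Ofin Au hv.
have le_O : (bregman h u v <= Omega A h)%E.
  by apply: ereal_sup_ubound; exists u, v.
have fv := ccp_fin _ _ ch (dgf_interior_edom _ _ _ hv).
have hu : edom h u.
  rewrite /edom/= ltey; apply/eqP => hu; have := le_lt_trans le_O Ofin.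
  by rewrite /bregman hu -(fineK fv).
split=> //; have := le_O; rewrite (bregmanE _ _ _ (ccp_fin _ _ ch hu) fv) => le_O'.
rewrite -lee_fin fineK// fin_numElt Ofin andbT.
by apply: lt_le_trans le_O'; rewrite ltNyr.
Qed.

Lemma rbregman_le_Omega' h u : ccp h -> [set x : V | `|x| <= 1] `<=` edom h ->
  (Omega' h < +oo)%E -> `|u| <= 1 -> rbregman h u 0 <= fine (Omega' h).
Proof.
move=> ch bh Ofin u1.
have : (bregman h u 0%R <= Omega' h)%E by apply: ereal_sup_ubound; exists u.
have fin w : `|w| <= 1 -> h w \is a fin_num by move=> /bh; exact: ccp_fin.
rewrite bregmanE ?fin ?normr0//.
move=> le_O; rewrite -lee_fin fineK// fin_numElt Ofin andbT.
by apply: lt_le_trans le_O; rewrite ltNyr.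
Qed.

Lemma rbregman_self h u : rbregman h u u = 0.
Proof. by rewrite /rbregman /grad !subrr linear0 subr0. Qed.

End OmegaBounds.

(** This is where the step sizes are spent. Weighted by [td], [Dxx] yields 2 L a^2 + (Lxx + e Lyx) T
    a^2, which pays the smoothness terms and the reserve t e Lyx a^2 / 2 handed to the next step;
    [Dyy] does the same for b^2. The old reserves in [an] and [bn], with part of [Dyy], absorb the
    change of the cross term from [qn] to [qn'], and Dy <= Oy lets the dual weight grow from n to n
    + 1. *)
Lemma energy_step (R : realFieldType) (n t T Q Q' B : R) (L Lxx Lyx Lyy e e' td ad : R)
  (D1 Dx Dx' Dxx Oy Dy Dy' Dyy : R) (qn qn' q' a an b bn : R) :
  0 <= n -> t = n + 1 -> t <= T -> 0 <= L -> 0 <= Lxx -> 0 <= Lyx -> 0 <= Lyy ->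
  0 <= e -> 0 <= e' -> 0 <= ad ->
  td = 4 * L + 2 * (Lxx + e * Lyx) * T -> ad = 16 * (e' * Lyx + Lyy) ->
  a ^+ 2 / 2 <= Dxx -> 0 <= td -> b ^+ 2 / 2 <= Dyy -> Dy <= Oy ->
  n * (n + 1) / 2 * Q <= td * (D1 - Dx) + n * ad * (Oy - Dy) + n * qn
     - n * e * Lyx / 2 * an ^+ 2 - n * Lyy / 2 * bn ^+ 2 ->
  t * (t + 1) / 2 * Q' <= n * (n + 1) / 2 * Q + t * B + L * a ^+ 2 ->
  t * B <= td * (Dx - Dx' - Dxx) + t * ad * (Dy - Dy' - Dyy) + t * Lxx / 2 * a ^+ 2
     + t * q' - n * qn' ->
  n * (qn - qn') <= n * ((Lyx * an + Lyy * bn) * b) ->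
  n * (an * b) <= n * (e / 2 * an ^+ 2 + e' / 2 * b ^+ 2) ->
  t * (t + 1) / 2 * Q' <= td * (D1 - Dx') + t * ad * (Oy - Dy') + t * q'
     - t * e * Lyx / 2 * a ^+ 2 - t * Lyy / 2 * b ^+ 2.
Proof.
move=> n0 -> tT L0 Lxx0 Lyx0 Lyy0 e0 e'0 ad0 etd ead Dxxa td0 Dyyb DyO IH step stepB qb ab.
have P1 : 0 <= td * (Dxx - a ^+ 2 / 2) by rewrite mulr_ge0// subr_ge0.
have P2 : 0 <= (n + 1) * ad * (Dyy - b ^+ 2 / 2).
  by rewrite !mulr_ge0// ?subr_ge0// addr_ge0.
have P3 : 0 <= ad * (Oy - Dy) by rewrite mulr_ge0// subr_ge0.
have P5 : n * Lyx * (an * b) <= n * Lyx * (e / 2 * an ^+ 2 + e' / 2 * b ^+ 2).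
  by rewrite (mulrC n) -(mulrA Lyx) -(mulrA Lyx) ler_wpM2l.
have [n10 LT0 eL0] : [/\ 0 <= n + 1, 0 <= T - (n + 1) & 0 <= e * Lyx].
  by split; rewrite ?subr_ge0// ?addr_ge0// mulr_ge0.
have sq_ge0 (x y : R) : 0 <= x -> 0 <= x * y ^+ 2.
  by move=> x0; rewrite mulr_ge0 ?sqr_ge0.
have P6 : 0 <= n * Lyy * (bn - b) ^+ 2 by rewrite sq_ge0 ?mulr_ge0.
have P7 : 0 <= (Lxx + e * Lyx) * (T - (n + 1)) * a ^+ 2.
  by rewrite sq_ge0 ?mulr_ge0// addr_ge0.
have P8 : 0 <= e * Lyx * (n + 1) * a ^+ 2 by rewrite sq_ge0 ?mulr_ge0.
have P9 : 0 <= Lxx * (n + 1) * a ^+ 2 by rewrite sq_ge0 ?mulr_ge0.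
have P10 : 0 <= n * e' * Lyx * b ^+ 2 by rewrite sq_ge0 ?mulr_ge0.
have P11 : 0 <= n * Lyy * b ^+ 2 by rewrite sq_ge0 ?mulr_ge0.
have P12 : 0 <= e' * Lyx * b ^+ 2 by rewrite sq_ge0 ?mulr_ge0.
have P13 : 0 <= Lyy * b ^+ 2 by rewrite sq_ge0.
have P14 : 0 <= L * a ^+ 2 by rewrite sq_ge0.
have Etd : td * (a ^+ 2 / 2) =
    2 * (L * a ^+ 2) + (Lxx + e * Lyx) * (T - (n + 1)) * a ^+ 2
    + Lxx * (n + 1) * a ^+ 2 + e * Lyx * (n + 1) * a ^+ 2.
  by rewrite etd; field.
have Ead : (n + 1) * ad * (b ^+ 2 / 2) = 8 * (n * e' * Lyx * b ^+ 2) + 8 * (n * Lyy * b ^+ 2)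
    + 8 * (e' * Lyx * b ^+ 2) + 8 * (Lyy * b ^+ 2).
  by rewrite ead; field.
clear etd ead.
lra.
Qed.

(** The cross term still pending after the last step is absorbed by the two reserves together with
    the dual divergence [Dv]. *)
Lemma energy_last (R : realFieldType) (n Q Lyx Lyy e e' td ad D1 Dx Oy Dv q a b w : R) :
  0 <= n -> 0 <= Lyx -> 0 <= Lyy -> 0 <= e' -> 0 <= td ->
  ad = 16 * (e' * Lyx + Lyy) -> 0 <= Dx -> 2^-1 * w ^+ 2 <= Dv ->
  q <= (Lyx * a + Lyy * b) * w -> a * w <= e / 2 * a ^+ 2 + e' / 2 * w ^+ 2 ->
  n * (n + 1) / 2 * Q <= td * (D1 - Dx) + n * ad * (Oy - Dv) + n * q
     - n * e * Lyx / 2 * a ^+ 2 - n * Lyy / 2 * b ^+ 2 ->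
  n * (n + 1) / 2 * Q <= td * D1 + n * ad * Oy.
Proof.
move=> n0 Lyx0 Lyy0 e'0 td0 -> Dx0 Dvw qw aw le_Q.
have P1 : 0 <= td * Dx by rewrite mulr_ge0.
have c0 : 0 <= n * (16 * (e' * Lyx + Lyy)) by rewrite !mulr_ge0// addr_ge0// mulr_ge0.
have P2 := ler_wpM2l c0 Dvw.
have P3 := ler_wpM2l n0 qw.
have P4 := ler_wpM2l (mulr_ge0 n0 Lyx0) aw.
have P5 : 0 <= n * Lyy * (b - w) ^+ 2 by rewrite mulr_ge0 ?sqr_ge0// mulr_ge0.
have P6 : 0 <= n * Lyy * w ^+ 2 by rewrite mulr_ge0 ?sqr_ge0// mulr_ge0.
have P7 : 0 <= n * (e' * Lyx) * w ^+ 2 by rewrite mulr_ge0 ?sqr_ge0// !mulr_ge0.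
lra.
Qed.

(** * Energy estimate for one run of the subroutine *)

Section Subroutine.
Context {R : realType} {X Y : normedModType R}.
Variables (P : spp X Y) (hP : spp_assumptions P) (mu_ge0 : 0 <= mu P).
Variables (hX : X -> \bar R) (hY : Y -> \bar R).
Hypotheses (dgfX : dgf (Xset P) hX) (dgfY : dgf (Yset P) hY).
Hypothesis rescX : rescaled_strongly_convex (Xset P) hX.
Hypothesis ball_dom : [set x : X | `|x| <= 1] `<=` edom hX.
Hypothesis OmegaY_fin : (Omega (Yset P) hY < +oo)%E.
Variables (c0 : X) (hc0 : dgf_interior (Xset P) hX c0).
Variables (x0 : X) (Xx0 : Xset P x0) (r : R) (r0 : 0 < r) (T : nat).
Variables aden tden e e' : R.
Hypotheses (aden_gt0 : 0 < aden) (tden_gt0 : 0 < tden).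
Hypotheses (e_ge0 : 0 <= e) (e'_ge0 : 0 <= e').
Hypothesis adenE : aden = 16 * (e' * Lyx P + Lyy P).
Hypothesis tdenE : tden = 4 * L P + 2 * (Lxx P + e * Lyx P) * T%:R.
(** [e] and [e'] stand for [eta] and its inverse. Young's inequality is assumed in place of e e' =
    1, which fails when both are 0. *)
Hypothesis amgm : forall u u' v v', Xset P u -> Xset P u' -> Yset P v -> Yset P v' ->
  `|u - u'| * `|v - v'| <= e / 2 * `|u - u'| ^+ 2 + e' / 2 * `|v - v'| ^+ 2.
Variables (x xb xt : nat -> X) (y yb : nat -> Y) (s : nat -> Y -> R).
Hypothesis run : subroutine_run P hX hY x0 r T (fun t => 2 / t.+1%:R) (fun=> aden^-1)
  (fun t => t%:R * tden^-1) (fun t => t.-1%:R / t%:R) x xb xt y yb s.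

Let h := rescaled hX x0 r.

Let chX : ccp hX. Proof. exact: dgf_ccp dgfX. Qed.
Let chY : ccp hY. Proof. exact: dgf_ccp dgfY. Qed.
Let h_gt_ninfty w : (-oo < h w)%E.
Proof. by apply: rescaled_gt_ninfty => // v; exact: ccp_gt_ninfty. Qed.
Let h_convex w w' (t : R) : edom h w -> edom h w' -> 0 <= t <= 1 ->
  edom h (t *: w + (1 - t) *: w').
Proof. exact: edom_rescaled_convex. Qed.
Let h_diff w : (edom h)° w -> differentiable (fun u => fine (h u) : R^o) w.
Proof.
rewrite interior_rescaled// => hw.
have dw := es_differentiable (dgf_essentially_smooth dgfX) hw.
by have [] := rescaled_grad hX x0 r w r0 dw.
Qed.
Let h_strong u v : Xset P u -> edom h u -> Xset P v -> (edom h)° v ->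
  2^-1 * `|u - v| ^+ 2 <= rbregman h u v.
Proof.
move=> Xu hu Xv hv; apply: (rescaled_strong_convexity (Xset P) _ c0) => //.
- exact: Xset_convex.
- exact: dgf_essentially_smooth dgfX.
Qed.

Definition step_weight (t : nat) : R := 2 / t.+1%:R.

Lemma step_weight_itv t : (0 < t)%N -> 0 <= step_weight t <= 1.
Proof.
move=> t0; rewrite /step_weight divr_ge0//= ler_pdivrMr ?ltr0n// mul1r.
by rewrite ler_nat.
Qed.

Lemma step_weight1 t : (0 < t)%N -> step_weight t != 1 -> (1 < t)%N.
Proof.
case: t => [|[|t]]//= _; rewrite /step_weight divff ?eqxx//.
Qed.

Let iterate t := [/\ Xset P (x t), Xset P (xb t), Yset P (y t) & Yset P (yb t)] /\
  ((edom h)° (x t) /\ (edom hY)° (y t)).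
Let finite_iterate t := (edom (g_ P) (x t) /\ edom (g_ P) (xb t)) /\
  (edom (J_ P) (y t) /\ edom (J_ P) (yb t)).

(** Finiteness of [g_ P] and [J_ P] is only claimed from index 2 on: the proximal points have it by
    definition, and weight 1 at the first step drops the starting point from the averages. *)
Lemma iterates_feasible t : (1 <= t <= T)%N ->
  iterate t /\ ((1 < t)%N -> finite_iterate t).
Proof.
have [[x1 xb1] [y1 yb1] _ step] := run.
elim: t => [//|[|t] IH] tT.
  split=> //; rewrite /iterate x1 xb1 yb1; case: y1 => Yy1 hy1.
  (* Rescaling sends the center to 0, which is interior because the unit ball lies in the domain of
     [hX]. *)
  split=> //; split=> //; rewrite interior_rescaled// subrr scaler0.
  exact: ball_interior.
have {IH}[|[[Xx Xxb Yy Yyb] [hx hy]] fin] := IH; first exact: ltnW.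
have [|[[Yy' _] _ [hy' Jy']] _ [[Xx' _] _ [hx' gx']] _ [xb' yb']] :=
  step t.+1; first exact: tT.
rewrite -/(step_weight t.+1) in xb' yb'.
rewrite x1 -/h in hx'.
have b01 := step_weight_itv t.+1 isT.
have dom w := step_weight1 t.+1 isT w.
have [] := ccp_average _ _ (xb t.+1) (x t.+2) _ (g_ccp hP) gx' b01.
  by move=> /dom /fin[[]].
rewrite -xb' => gxb' _.
have [] := ccp_average _ _ (yb t.+1) (y t.+2) _ (J_ccp hP) Jy' b01.
  by move=> /dom /fin[_ []].
rewrite -yb' => Jyb' _.
split=> // ; split=> //; split=> //.
- by rewrite xb' addrC; apply: convex_setP => //; exact: Xset_convex.
- by rewrite yb' addrC; apply: convex_setP => //; exact: Yset_convex.
Qed.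

Let q t d : R := grady P (x t.+1) (y t.+1) d - grady P (x t) (y t) d.

(** Multiplying by t + 1 clears the denominator of theta = t / (t + 1). At t = 0 the correction
    vanishes, in agreement with the initial [s 1]. *)
Lemma extrapolation t d : (t.+1 <= T)%N ->
  t.+1%:R * s t.+1 d = t.+1%:R * grady P (x t.+1) (y t.+1) d + t%:R * q t d.
Proof.
have [_ _ s1 step] := run.
case: t => [_|t tT]; first by rewrite s1 mul0r addr0.
have [|_ _ _ -> _] := step t.+1; first exact: tT.
have : t.+2%:R != 0 :> R by rewrite pnatr_eq0.
rewrite /q /=; move: (t.+2%:R) => k k0; field.
exact: k0.
Qed.

(** Sum of the two three-point inequalities times t. The primal coefficient tden / t becomes the
    constant [tden], the dual one becomes t aden. *)
Lemma mirror_steps t u v : (1 <= t < T)%N -> Xset P u -> edom (g_ P) u -> edom h u ->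
  Yset P v -> edom (J_ P) v ->
  t%:R * (fine (g_ P (x t.+1)) - fine (g_ P u) + fine (J_ P (y t.+1)) - fine (J_ P v)
      + grad (f_ P) ((1 - step_weight t) *: xb t + step_weight t *: x t) (x t.+1 - u)
      + gradx P (x t) (y t.+1) (x t.+1 - u)) <=
  tden * (rbregman h u (x t) - rbregman h u (x t.+1) - rbregman h (x t.+1) (x t))
  + t%:R * aden *
    (rbregman hY v (y t) - rbregman hY v (y t.+1) - rbregman hY (y t.+1) (y t))
  + t%:R * s t (y t.+1 - v).
Proof.
move=> tT Xu gu hu Yv Jv; have /andP[t0 /ltnW tT'] := tT.
have [|[[Xx _ Yy _] [hx hy]] _] := iterates_feasible t; first by rewrite t0.
have [[x1 _] _ _ step] := run.
have [[miny _ [hy' Jy']] ext [minx _ [hx' gx']] _ _] := step t tT.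
(* [s t] is a bare function; its linearity is recovered from that of the gradients, after division
   by t > 0. *)
have sZ d : t%:R * s t d = t%:R * grady P (x t) (y t) d + t.-1%:R * q t.-1 d.
  by have := extrapolation t.-1 d; rewrite prednK//; apply.
have sD a d d' : s t (a *: d + d') = a * s t d + s t d'.
  have tn0 : t%:R != 0 :> R by rewrite pnatr_eq0 -lt0n.
  apply: (mulfI tn0); rewrite mulrDr mulrCA !sZ.
  by rewrite /q prednK// !gradyP; ring.
have sN d : s t (- d) = - s t d.
  have s0 : s t 0 = 0 by have := sD 1 0 0; rewrite scaler0 addr0; lra.
  by have := sD (-1) d 0; rewrite scaleN1r addr0 s0 addr0 mulN1r.
pose ly w : R := - s t (w - y t).
have ly_aff w w' (l : R) : ly (l *: w + (1 - l) *: w') = l * ly w + (1 - l) * ly w'.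
  rewrite /ly (_ : _ - y t = l *: (w - y t) + (1 - l) *: (w' - y t)); last first.
    by have := affine_scale (y t) 1 w w' l; rewrite invr1 !scale1r.
  rewrite sD -[_ *: (w' - _)]addr0 sD.
  by have := sD 1 0 0; rewrite scaler0 addr0; lra.
have hY0 : edom hY (y t) by exact: interior_subset.
have [hYv _] := rbregman_le_Omega _ _ v (y t) chY OmegaY_fin Yv (conj Yy hy).
have dhY := es_differentiable (dgf_essentially_smooth dgfY) hy'.
have Py : fine (J_ P (y t.+1)) + ly (y t.+1) <= fine (J_ P v) + ly v +
    aden * (rbregman hY v (y t) - rbregman hY v (y t.+1) - rbregman hY (y t.+1) (y t)).
  apply: (prox_three_points (Yset P) (J_ P) hY) => //.
  - exact: Yset_convex.
  - exact: J_ccp.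
  - by move=> w; exact: ccp_gt_ninfty.
  - by move=> w w' l hw hw' l01; have [] := ccp_fine_convex _ _ _ l chY hw hw' l01.
  - exact: interior_subset.
  - by move: miny; rewrite invrK /ly; under [X in minimizer _ X]eq_fun do rewrite -EFinN.
pose xm := (1 - step_weight t) *: xb t + step_weight t *: x t.
pose lx w : R := gradx P (x t) (y t.+1) (w - x t) + grad (f_ P) xm (w - x t).
have lx_aff w w' (l : R) : lx (l *: w + (1 - l) *: w') = l * lx w + (1 - l) * lx w'.
  rewrite /lx (_ : _ - x t = l *: (w - x t) + (1 - l) *: (w' - x t)); last first.
    by have := affine_scale (x t) 1 w w' l; rewrite invr1 !scale1r.
  rewrite gradxP gradfP gradxZ gradfZ; ring.
have Px : fine (g_ P (x t.+1)) + lx (x t.+1) <= fine (g_ P u) + lx u +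
    (t%:R / tden)^-1 *
    (rbregman h u (x t) - rbregman h u (x t.+1) - rbregman h (x t.+1) (x t)).
  have hu' : (edom h)° (x t.+1) by move: hx'; rewrite x1.
  have k0 : 0 < (t%:R / tden)^-1 by rewrite invr_gt0 divr_gt0// ltr0n.
  have hxt : edom h (x t) by exact: interior_subset.
  have hxt' : edom h (x t.+1) by exact: interior_subset.
  have minx' : minimizer (Xset P)
      (fun w => g_ P w + (lx w)%:E + (t%:R / tden)^-1%:E * bregman h w (x t))%E (x t.+1).
    by move: minx; rewrite x1 ext.
  exact: (prox_three_points (Xset P) (g_ P) h lx _ _ _ _ (Xset_convex hP) (g_ccp hP)
    h_gt_ninfty h_convex lx_aff k0 hxt hxt' gx' (h_diff _ hu') minx' Xu gu hu).
have lxE : lx u = lx (x t.+1) - gradx P (x t) (y t.+1) (x t.+1 - u)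
    - grad (f_ P) xm (x t.+1 - u).
  rewrite /lx (_ : u - x t = (-1) *: (x t.+1 - u) + (x t.+1 - x t)).
    by rewrite gradxP gradfP; ring.
  by rewrite scaleN1r opprB addrA subrK.
have lyE : ly v = ly (y t.+1) + s t (y t.+1 - v).
  rewrite /ly (_ : v - y t = (-1) *: (y t.+1 - v) + (y t.+1 - y t)).
    by rewrite sD; ring.
  by rewrite scaleN1r opprB addrA subrK.
have tR : 0 < t%:R :> R by rewrite ltr0n.
have Ek (z : R) : t%:R * ((t%:R / tden)^-1 * z) = tden * z.
  by move: (t%:R) tR => k k0; field; rewrite !gt_eqF.
have := ler_wpM2l (ltW tR) Px; rewrite [leRHS]mulrDr Ek lxE.
have := ler_wpM2l (ltW tR) Py; rewrite lyE.
rewrite -/xm; lra.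
Qed.

(** The last three terms make the induction close: the cross term of the extrapolated gradient, not
    yet bounded, and the reserves that will pay for its change. *)
Lemma energy n u v : (n < T)%N -> Xset P u -> edom (g_ P) u -> edom h u ->
  Yset P v -> edom (J_ P) v ->
  n%:R * (n%:R + 1) / 2 * (rsaddle P (xb n.+1) v - rsaddle P u (yb n.+1)) <=
  tden * (rbregman h u (x 1%N) - rbregman h u (x n.+1))
  + n%:R * aden * (OmegaY P hY - rbregman hY v (y n.+1))
  + n%:R * q n (v - y n.+1)
  - n%:R * e * Lyx P / 2 * `|x n.+1 - x n| ^+ 2
  - n%:R * Lyy P / 2 * `|y n.+1 - y n| ^+ 2.
Proof.
move=> nT Xu gu hu Yv Jv; elim: n nT => [_|n IH nT].
  (* The factor n = 0 removes the meaningless index 0 and the value of [rsaddle] at starting points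
     outside the domains. *)
  by rewrite !mul0r subrr mulr0 !addr0 subr0.
have {}IH := IH (ltnW nT).
have [|[[Xx Xxb Yy Yyb] [hx hy]] fin] := iterates_feasible n.+1; first exact: ltnW.
have [[[Xx' Xxb' Yy' Yyb'] [hx' hy']] /(_ isT)[[gx' _] [Jy' _]]] :=
  iterates_feasible n.+2 nT.
have b01 := step_weight_itv n.+1 isT.
have dom : step_weight n.+1 != 1 -> edom (g_ P) (xb n.+1) /\ edom (J_ P) (yb n.+1).
  by move=> /step_weight1 -/(_ isT) /fin[[_ ?] [_ ?]].
have hYv := rbregman_le_Omega _ _ v (y n.+1) chY OmegaY_fin Yv (conj Yy hy).
pose B := fine (g_ P (x n.+2)) - fine (g_ P u) + fine (J_ P (y n.+2)) - fine (J_ P v)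
  + grad (f_ P) ((1 - step_weight n.+1) *: xb n.+1 + step_weight n.+1 *: x n.+1)
      (x n.+2 - u)
  + gradx P (x n.+1) (y n.+2) (x n.+2 - u) + Lxx P / 2 * `|x n.+2 - x n.+1| ^+ 2
  + grady P (x n.+2) (y n.+2) (v - y n.+2).
apply: (energy_step R n%:R n.+1%:R T%:R
  (rsaddle P (xb n.+1) v - rsaddle P u (yb n.+1)) _ B
  (L P) (Lxx P) (Lyx P) (Lyy P) e e' tden aden
  (rbregman h u (x 1%N)) (rbregman h u (x n.+1)) _ (rbregman h (x n.+2) (x n.+1))
  (OmegaY P hY) (rbregman hY v (y n.+1)) _ (rbregman hY (y n.+2) (y n.+1))
  (q n (v - y n.+1)) (q n (v - y n.+2)) _ _ `|x n.+1 - x n| _ `|y n.+1 - y n|) => //.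
- by rewrite natr1.
- by rewrite ler_nat ltnW.
- exact: L_ge0.
- exact: Lxx_ge0.
- exact: Lyx_ge0.
- exact: Lyy_ge0.
- exact: ltW.
- have hx2 : edom h (x n.+2) by exact: interior_subset.
  by have := h_strong _ _ Xx' hx2 Xx hx; rewrite mulrC.
- exact: ltW.
- rewrite mulrC -lee_fin -bregmanE; last 2 first.
  + by apply: ccp_fin => //; exact: interior_subset.
  + by apply: ccp_fin => //; exact: interior_subset.
  exact: (dgf_strongly_convex dgfY).
- by have [] := hYv.
- have [[x1 _] _ _ step] := run.
  have [|_ _ _ _ [-> ->]] := step n.+1; first exact: nT.
  have := gap_averaging_step P hP (xb n.+1) (yb n.+1) (x n.+1) (x n.+2) (y n.+2) u v _
    b01 mu_ge0 Xxb Yyb Xx Xx' Yy' Xu Yv gx' Jy' dom.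
  rewrite -/B -/(step_weight n.+1).
  have k0 : 0 <= n.+1%:R * (n.+1%:R + 1) / 2 :> R.
    by rewrite divr_ge0// mulr_ge0 ?addr_ge0.
  move=> /(ler_wpM2l k0) /le_trans; apply; rewrite -/B.
  set a := `|x n.+2 - x n.+1|.
  have a0 : 0 <= a ^+ 2 by rewrite sqr_ge0.
  have n2 : 0 < n.+1%:R + 1 :> R by rewrite ltr_wpDl.
  (* With t = n + 1 and b = 2 / (t + 1), the smoothness term of [f_ P] is L a^2 t / (t + 1), short
     of L a^2 by the amount displayed. *)
  rewrite -subr_ge0 [X in 0 <= X](_ : _ = L P * a ^+ 2 / (n.+1%:R + 1)).
    by apply: divr_ge0; [apply: mulr_ge0 => //; exact: (L_ge0 hP)|exact: ltW].
  rewrite /step_weight -(natr1 n.+1); move: n2; rewrite -(natr1 n); move: (n%:R) => m m0.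
  by field; rewrite gt_eqF.
- have := mirror_steps n.+1 u v nT Xu gu hu Yv Jv.
  rewrite (extrapolation n _ (ltnW nT)) /B -/(q n).
  have dv : y n.+2 - v = (-1) *: (v - y n.+2) by rewrite scaleN1r opprB.
  have qN : q n (y n.+2 - v) = - q n (v - y n.+2).
    by rewrite dv /q !gradyZ; ring.
  have gN : grady P (x n.+1) (y n.+1) (y n.+2 - v) =
      - grady P (x n.+1) (y n.+1) (v - y n.+2).
    by rewrite dv gradyZ mulN1r.
  rewrite qN gN [q n.+1 _]/q; lra.
- have [->|n0] := posnP n; first by rewrite !mul0r.
  have [|[[Xxn _ Yyn _] _] _] := iterates_feasible n; first by rewrite n0 ltnW// ltnW.
  apply: ler_wpM2l => //.
  have -> : q n (v - y n.+1) - q n (v - y n.+2) = q n (y n.+2 - y n.+1).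
    have -> : v - y n.+1 = 1 *: (y n.+2 - y n.+1) + (v - y n.+2).
      by rewrite scale1r [RHS]addrC addrA subrK.
    by rewrite /q !gradyP; ring.
  by apply: le_trans (ler_norm _) _; exact: grady_lip.
- have [->|n0] := posnP n; first by rewrite !mul0r.
  have [|[[Xxn _ Yyn _] _] _] := iterates_feasible n; first by rewrite n0 ltnW// ltnW.
  exact/ler_wpM2l/amgm.
Qed.

Lemma subroutine_bound u v : (1 < T)%N -> Xset P u -> edom (g_ P) u -> edom h u ->
  Yset P v -> edom (J_ P) v ->
  T%:R * (T%:R - 1) / 2 * (rsaddle P (xb T) v - rsaddle P u (yb T)) <=
  tden * rbregman h u x0 + (T%:R - 1) * aden * OmegaY P hY.
Proof.
move=> T1 Xu gu hu Yv Jv.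
have [n TE] : exists n, T = n.+1 by exists T.-1; rewrite prednK// ltnW.
have nT : (n < T)%N by rewrite TE.
have n1 : (0 < n)%N by rewrite -ltnS -TE.
rewrite TE.
have := energy n u v nT Xu gu hu Yv Jv.
have [|[[Xx _ Yy _] _] _] := iterates_feasible n; first by rewrite n1 ltnW.
have [|[[Xx' _ Yy' _] [hx' hy']] _] := iterates_feasible n.+1; first exact: nT.
have [[-> _] _ _ _] := run.
have Du : 0 <= rbregman h u (x n.+1).
  by apply: le_trans (h_strong _ _ Xu hu Xx' hx'); rewrite mulr_ge0 ?sqr_ge0.
have [hv _] := rbregman_le_Omega _ _ v _ chY OmegaY_fin Yv (conj Yy' hy').
have Dv : 2^-1 * `|v - y n.+1| ^+ 2 <= rbregman hY v (y n.+1).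
  rewrite -lee_fin -bregmanE; last 2 first.
  - exact: ccp_fin.
  - by apply: ccp_fin => //; exact: interior_subset.
  exact: (dgf_strongly_convex dgfY).
have := grady_lip P hP (x n.+1) (x n) (y n.+1) (y n) (v - y n.+1) Xx' Xx Yy' Yy.
rewrite -/(q n (v - y n.+1)) => /(le_trans (ler_norm _)).
have := amgm (x n.+1) (x n) v (y n.+1) Xx' Xx Yv Yy'.
rewrite -(natr1 n) addrK (mulrC (n%:R + 1)) => aw qw le_Q.
by apply: (energy_last R _ _ _ _ _ _ _ _ _ _ _ _ _ _ _ _ _ _ _ _ _ adenE Du Dv qw aw le_Q);
  rewrite ?(ltW tden_gt0) ?(Lyx_ge0 hP) ?(Lyy_ge0 hP).
Qed.

End Subroutine.

(** Each lower bound on [T] buys a share of mu r^2: the primal part is at most 5/1024 T^2 and the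
    dual part at most 3/1024 T (T - 1). Since T >= 3 gives T^2 <= 3/2 T (T - 1), division by T (T -
    1) / 2 leaves 21/1024. *)
Lemma stage_arith (R : realFieldType) (T r mu Q L Lxx Lyx Lyy e e' td ad OX OY w D : R) :
  3 <= T -> 0 < r -> 0 < mu -> 0 <= Lyx ->
  0 <= td -> td = 4 * L + 2 * (Lxx + e * Lyx) * T -> ad = 16 * (e' * Lyx + Lyy) ->
  e * (r ^+ 2 * OX) <= 4 * r * w -> e' * OY <= r / 4 * w ->
  4096 * (L * OX) <= mu * T ^+ 2 -> 1024 * (Lxx * OX) <= mu * T ->
  4096 * (Lyx * w) <= mu * r * T -> 8192 * (Lyy * OY) <= mu * r ^+ 2 * T ->
  D <= r ^+ 2 * OX ->
  T * (T - 1) / 2 * Q <= td * D + (T - 1) * ad * OY ->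
  Q <= 3 / 128 * mu * r ^+ 2.
Proof.
move=> T3 r0 mu0 Lyx0 td0 etd -> eX eY hL hLxx hLyx hLyy DX le_Q.
have T0 : 0 < T by apply: lt_le_trans T3.
have T1 : 0 < T - 1 by rewrite subr_gt0 (lt_le_trans _ T3)// ltr1n.
have r20 : 0 <= r ^+ 2 by rewrite sqr_ge0.
have TT : 0 < T * (T - 1) / 2 by rewrite divr_gt0 ?mulr_gt0.
rewrite -(ler_pM2l TT); apply: le_trans le_Q _.
have H0 := ler_wpM2l td0 DX.
have H1 := ler_wpM2l r20 hL.
have H2 := ler_wpM2l (mulr_ge0 r20 (ltW T0)) hLxx.
have H3 := ler_wpM2l (mulr_ge0 Lyx0 (ltW T0)) eX.
have H4 := ler_wpM2l (mulr_ge0 (ltW r0) (ltW T0)) hLyx.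
have H5 := ler_wpM2l (mulr_ge0 (ltW T1) Lyx0) eY.
have H6 := ler_wpM2l (mulr_ge0 (ltW T1) (ltW r0)) hLyx.
have H7 := ler_wpM2l (ltW T1) hLyy.
have H9 : 0 <= mu * r ^+ 2 * T.
  by apply: mulr_ge0; [apply: mulr_ge0|]; rewrite // ltW.
have H8 : 0 <= mu * r ^+ 2 * T * (T - 3) by rewrite mulr_ge0 ?subr_ge0.
move: H0; rewrite etd => H0.
lra.
Qed.

(** * The primal ball, degenerate sets and the balancing role of [eta] *)

Section Stage.
Context {R : realType} {X Y : normedModType R}.
Variables (P : spp X Y) (hP : spp_assumptions P) (mu_gt0 : 0 < mu P).
Variables (hX : X -> \bar R) (hY : Y -> \bar R).
Hypotheses (dgfX : dgf (Xset P) hX) (dgfY : dgf (Yset P) hY).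
Hypothesis rescX : rescaled_strongly_convex (Xset P) hX.
Hypothesis ball_dom : [set x : X | `|x| <= 1] `<=` edom hX.
Hypothesis OmegaX_fin : (Omega' hX < +oo)%E.
Hypothesis OmegaY_fin : (Omega (Yset P) hY < +oo)%E.
Variables (c0 : X) (hc0 : dgf_interior (Xset P) hX c0).
Variables (d0 : Y) (hd0 : dgf_interior (Yset P) hY d0).

Let chX : ccp hX. Proof. exact: dgf_ccp dgfX. Qed.
Let chY : ccp hY. Proof. exact: dgf_ccp dgfY. Qed.

Lemma rescaled_ball c r u : 0 < r -> `|u - c| <= r ->
  edom (rescaled hX c r) u /\
  rbregman (rescaled hX c r) u c <= r ^+ 2 * OmegaX hX.
Proof.
move=> r0 ucr.
have u1 : `|r^-1 *: (u - c)| <= 1.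
  by rewrite normrZ gtr0_norm ?invr_gt0// ler_pdivrMl// mulr1.
split; first by rewrite edom_rescaled//; exact: ball_dom.
have d0X := es_differentiable (dgf_essentially_smooth dgfX) (ball_interior _ ball_dom).
rewrite rbregman_rescaled// subrr scaler0//.
rewrite ler_wpM2l ?sqr_ge0//; exact: rbregman_le_Omega'.
Qed.

Lemma OmegaX_ge0 : 0 <= OmegaX hX.
Proof.
rewrite -(rbregman_self hX 0); apply: rbregman_le_Omega' => //.
by rewrite normr0.
Qed.

Lemma OmegaY_ge0 : 0 <= OmegaY P hY.
Proof.
rewrite -(rbregman_self hY d0).
by have [] := rbregman_le_Omega _ _ d0 d0 chY OmegaY_fin hd0.1 hd0.
Qed.

(** [OmegaX] only sees the unit ball, so the function is rescaled around [c0] until that ball covers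
    [u]; strong convexity then bounds |u - c0|^2 / 2 by r^2 [OmegaX] = 0. *)
Lemma OmegaX_eq0 u : OmegaX hX = 0 -> Xset P u -> u = c0.
Proof.
move=> O0 Xu; pose r := `|u - c0| + 1.
have r0 : 0 < r by rewrite ltr_wpDl.
have [|hu le0] := rescaled_ball c0 r u r0; first by rewrite lerDl.
have hc : dgf_interior (Xset P) (rescaled hX c0 r) c0.
  split; first exact: hc0.1.
  by rewrite interior_rescaled// subrr scaler0; exact: ball_interior.
have := rescaled_strong_convexity (Xset P) hX c0 c0 r u c0 (Xset_convex hP) chX
  (dgf_essentially_smooth dgfX) rescX hc0 hc0.1 r0 Xu hu hc.
move=> /le_trans /(_ le0); rewrite O0 mulr0 pmulr_rle0 ?invr_gt0// => sq0.
apply/eqP; rewrite -subr_eq0 -normr_eq0 -sqrf_eq0 eq_le sq0.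
by rewrite sqr_ge0.
Qed.

Lemma OmegaY_eq0 v : OmegaY P hY = 0 -> Yset P v -> v = d0.
Proof.
move=> O0 Yv.
have [hv le0] := rbregman_le_Omega _ _ v d0 chY OmegaY_fin Yv hd0.
have := dgf_strongly_convex dgfY Yv hd0.
have hd := dgf_interior_edom _ _ _ hd0.
rewrite (bregmanE _ _ _ (ccp_fin _ _ chY hv) (ccp_fin _ _ chY hd)).
rewrite lee_fin.
move=> /le_trans /(_ le0); rewrite -/(OmegaY P hY) O0 pmulr_rle0 ?invr_gt0// => sq0.
apply/eqP; rewrite -subr_eq0 -normr_eq0 -sqrf_eq0 eq_le sq0.
by rewrite sqr_ge0.
Qed.

(* When [OmegaX] or [OmegaY] vanishes, so do both [eta] and its inverse, but then
   one of the feasible sets is a singleton and the left-hand side is zero. *)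
Lemma eta_amgm r u u' v v' : 0 < r ->
  Xset P u -> Xset P u' -> Yset P v -> Yset P v' ->
  `|u - u'| * `|v - v'| <=
    eta P hX hY r / 2 * `|u - u'| ^+ 2 + (eta P hX hY r)^-1 / 2 * `|v - v'| ^+ 2.
Proof.
move=> r0 Xu Xu' Yv Yv'.
have e0 : 0 <= eta P hX hY r by rewrite mulr_ge0 ?divr_ge0 ?sqrtr_ge0// ltW.
have rhs0 : 0 <= eta P hX hY r / 2 * `|u - u'| ^+ 2 +
    (eta P hX hY r)^-1 / 2 * `|v - v'| ^+ 2.
  by rewrite addr_ge0// mulr_ge0 ?sqr_ge0 ?divr_ge0 ?invr_ge0.
have [OX0|OX0] := eqVneq (OmegaX hX) 0.
  by move: rhs0; rewrite (OmegaX_eq0 u)// (OmegaX_eq0 u')// subrr normr0 mul0r.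
have [OY0|OY0] := eqVneq (OmegaY P hY) 0.
  by move: rhs0; rewrite (OmegaY_eq0 v)// (OmegaY_eq0 v')// subrr normr0 mulr0.
have eta0 : 0 < eta P hX hY r.
  rewrite mulr_gt0 ?divr_gt0// sqrtr_gt0 divr_gt0// lt0r.
  - by rewrite OY0 OmegaY_ge0.
  - by rewrite OX0 OmegaX_ge0.
move: eta0; set z := eta _ _ _ _ => z0; set a := `|u - u'|; set b := `|v - v'|.
rewrite -subr_ge0 (_ : _ - _ = z^-1 / 2 * (z * a - b) ^+ 2).
  by rewrite mulr_ge0 ?sqr_ge0 ?divr_ge0 ?invr_ge0 ?ltW.
by field; rewrite gt_eqF.
Qed.

(** [eta] is chosen to balance the two coupling terms: this one and its dual counterpart are both
    multiples of r times the same square root. *)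
Lemma eta_OmegaX r : 0 < r -> eta P hX hY r * (r ^+ 2 * OmegaX hX) <=
  4 * r * Num.sqrt (OmegaX hX * OmegaY P hY).
Proof.
move=> r0; have OX0 := OmegaX_ge0; have OY0 := OmegaY_ge0.
have [OXe|OXn] := eqVneq (OmegaX hX) 0; first by rewrite OXe !mulr0 mul0r sqrtr0 mulr0.
rewrite /eta !sqrtrM// sqrtrV//.
rewrite -{2}(sqr_sqrtr OX0) le_eqVlt; apply/orP; left; apply/eqP.
have : Num.sqrt (OmegaX hX) != 0 by rewrite sqrtr_eq0 -ltNge lt0r OXn.
move: (Num.sqrt (OmegaX hX)) => a a0; field.
by rewrite a0 gt_eqF.
Qed.

Lemma eta_OmegaY r : 0 < r -> (eta P hX hY r)^-1 * OmegaY P hY <=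
  r / 4 * Num.sqrt (OmegaX hX * OmegaY P hY).
Proof.
move=> r0; have OX0 := OmegaX_ge0; have OY0 := OmegaY_ge0.
have [OXe|OXn] := eqVneq (OmegaX hX) 0.
  by rewrite /eta OXe invr0 mulr0 sqrtr0 mulr0 invr0 !mul0r sqrtr0 mulr0.
have [OYe|OYn] := eqVneq (OmegaY P hY) 0; first by rewrite OYe !mulr0 sqrtr0 mulr0.
rewrite /eta !sqrtrM// sqrtrV//.
rewrite -{2}(sqr_sqrtr OY0) le_eqVlt; apply/orP; left; apply/eqP.
have : Num.sqrt (OmegaX hX) != 0 by rewrite sqrtr_eq0 -ltNge lt0r OXn.
have : Num.sqrt (OmegaY P hY) != 0 by rewrite sqrtr_eq0 -ltNge lt0r OYn.
move: (Num.sqrt (OmegaX hX)) (Num.sqrt (OmegaY P hY)) => a b b0 a0; field.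
by rewrite a0 b0 gt_eqF.
Qed.

End Stage.

(** * From a local to a global gap bound *)

Section Localization.
Context {R : realType} {X Y : normedModType R}.
Variables (P : spp X Y) (hP : spp_assumptions P) (mu_gt0 : 0 < mu P).

Lemma rsaddle_segment u u' v (t : R) : Xset P u -> Xset P u' -> edom (g_ P) u ->
  edom (g_ P) u' -> Yset P v -> 0 <= t <= 1 ->
  [/\ Xset P (t *: u + (1 - t) *: u'), edom (g_ P) (t *: u + (1 - t) *: u') &
  rsaddle P (t *: u + (1 - t) *: u') v <=
    t * rsaddle P u v + (1 - t) * rsaddle P u' v
    - mu P / 2 * (t * (1 - t)) * `|u - u'| ^+ 2].
Proof.
move=> Xu Xu' gu gu' Yv t01.
have [gz gle] := ccp_fine_convex _ u u' t (g_ccp hP) gu gu' t01.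
split=> //; first exact: convex_setP _ _ _ _ (Xset_convex hP) Xu Xu' t01.
have := f_strong_segment P hP u u' t Xu Xu' t01.
have := convex_functionP _ _ u u' t (Phi_convex hP Yv) Xu Xu' t01.
rewrite /rsaddle; move: gle; lra.
Qed.

Definition real_saddle_point (xs : X) (ys : Y) :=
  [/\ Xset P xs, Yset P ys, edom (g_ P) xs & edom (J_ P) ys] /\
  forall x y, Xset P x -> edom (g_ P) x -> Yset P y -> edom (J_ P) y ->
    rsaddle P xs y <= rsaddle P xs ys /\ rsaddle P xs ys <= rsaddle P x ys.

(** The order matters: an infinite [J_ P ys] makes the saddle value -oo whatever [g_ P xs] is,
    against a finite competitor in y; only then does an infinite [g_ P xs] give +oo, against a
    finite competitor in x. *)
Lemma real_saddle_point_exists : exists xs ys, real_saddle_point xs ys.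
Proof.
have [xs [ys [Xxs Yys S]]] := saddle_point_exists hP; exists xs, ys.
have [x1 [gx1 Xx1]] := g_dom hP; have [y1 [Jy1 Yy1]] := J_dom hP.
have [S1 S2] := S x1 y1 Xx1 Yy1.
have Jys : edom (J_ P) ys.
  rewrite /edom/= ltey; apply/eqP => Jys; move: S1.
  rewrite /saddle Jys -(fineK (ccp_fin _ _ (J_ccp hP) Jy1)) -(fineK (f_fin P hP xs Xxs)).
  have := ccp_gt_ninfty (g_ccp hP) xs; case: (g_ P xs) => //.
have gxs : edom (g_ P) xs.
  rewrite /edom/= ltey; apply/eqP => gxs; move: S2.
  rewrite (rsaddleE P hP x1 ys Xx1 gx1 Jys) /saddle gxs.
  by rewrite -(fineK (ccp_fin _ _ (J_ccp hP) Jys)) -(fineK (f_fin P hP xs Xxs)).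
split=> // x y Xx gx Yy Jy; have := S x y Xx Yy.
by rewrite !rsaddleE// !lee_fin.
Qed.

(* The local gap bound only sees the ball of radius [r] around [x0], but by strong
   convexity it pins [xb] down near [xs], and a competitor [u] outside the ball is
   beaten by the point of the segment [xb, u] at distance [r / 4] from [xb]. *)
Lemma gap_localization xs ys x0 r xb yb : real_saddle_point xs ys -> 0 < r ->
  `|xs - x0| <= r / 2 ->
  Xset P xb -> Yset P yb -> edom (g_ P) xb -> edom (J_ P) yb ->
  (forall u v, Xset P u -> edom (g_ P) u -> `|u - x0| <= r -> Yset P v -> edom (J_ P) v ->
     rsaddle P xb v - rsaddle P u yb <= 3 / 128 * mu P * r ^+ 2) ->
  `|xs - xb| <= r / 4 /\
  forall u v, Xset P u -> edom (g_ P) u -> Yset P v -> edom (J_ P) v ->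
     rsaddle P xb v - rsaddle P u yb <= 3 / 128 * mu P * r ^+ 2.
Proof.
move=> [[Xs Ys gs Js] sad] r0 xsr Xb Yb gb Jb loc.
have near : `|xs - xb| <= r / 4.
  (* Weight 1/4 makes the constants match: 3/32 mu |xb - xs|^2 <= 1/4 (3/128) mu r^2 is exactly |xb
     - xs| <= r / 4, whereas the midpoint would only give sqrt (3/32) r. *)
  have q01 : 0 <= (4^-1 : R) <= 1 by rewrite invr_ge0 ler0n invf_le1// ler1n.
  have [Xz gz Sz] := rsaddle_segment xb xs ys 4^-1 Xb Xs gb gs Ys q01.
  have [_ S1] := sad _ ys Xz gz Ys Js.
  have [S2 _] := sad xs yb Xs gs Yb Jb.
  have := loc xs ys Xs gs; rewrite (le_trans xsr) => [/(_ isT Ys Js) S3|]; last first.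
    by rewrite ler_pdivrMr// ler_pMr// ler1n.
  have : mu P * `|xb - xs| ^+ 2 <= mu P * (r / 4) ^+ 2 by lra.
  rewrite ler_pM2l// distrC ler_pXn2r// ?nnegrE// divr_ge0// ltW //.
split=> // u v Xu gu Yv Jv.
have [ur|ur] := leP `|u - x0| r; first exact: loc.
pose d := `|u - xb|.
have dr : r / 4 < d.
  have : `|u - x0| <= d + `|xs - xb| + `|xs - x0|.
    rewrite -addrA (_ : u - x0 = (u - xb) + ((xb - xs) + (xs - x0))); last first.
      by rewrite !addrA !subrK.
    by rewrite (le_trans (ler_normD _ _))// lerD2l (distrC xs xb) ler_normD.
  lra.
have d0 : 0 < d by apply: le_lt_trans dr; rewrite divr_ge0// ltW.
pose l := r / 4 / d.
have l0 : 0 < l by rewrite !divr_gt0.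
have l1 : l <= 1 by rewrite ler_pdivrMr// mul1r ltW.
have ld : l * d = r / 4 by rewrite /l divfK// gt_eqF.
have [|Xz gz Sz] := rsaddle_segment u xb yb l Xu Xb gu gb Yb; first by rewrite (ltW l0).
move: Xz gz Sz; set z := _ + _ => Xz gz Sz.
(* The three distances r/4, r/4 and r/2 along [z], [xb], [xs], [x0] exhaust the radius. *)
have zr : `|z - x0| <= r.
  rewrite (_ : z - x0 = l *: (u - xb) + ((xb - xs) + (xs - x0))); last first.
    rewrite /z scalerBl scale1r scalerBr !addrA subrK; congr (_ - _).
    by rewrite addrAC.
  rewrite (le_trans (ler_normD _ _))// normrZ gtr0_norm// -/d ld.
  have := ler_normD (xb - xs) (xs - x0); rewrite (distrC xb); lra.
have S1 := loc z v Xz gz zr Yv Jv; have S2 := loc z yb Xz gz zr Yb Jb.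
suff : rsaddle P z yb <= rsaddle P u yb by lra.
rewrite -(ler_pM2l l0).
(* Hence strong convexity gains at least (1 - l) mu r^2 / 32, which covers the (1 - l) (3/128) mu
   r^2 that [xb] may lose to [z] by the local bound. *)
have dl : (r / 4) ^+ 2 <= l * d ^+ 2.
  by rewrite -ld exprMn ler_wpM2r ?sqr_ge0// expr2 ler_piMl// ltW.
have l1' : 0 <= 1 - l by rewrite subr_ge0.
have H1 := ler_wpM2l l1' S2.
have H2 := ler_wpM2l (mulr_ge0 l1' (ltW mu_gt0)) dl.
have H3 : 0 <= (1 - l) * mu P * r ^+ 2 by rewrite mulr_ge0 ?sqr_ge0// mulr_ge0// ltW.
rewrite -/d in Sz; lra.
Qed.

End Localization.

(** * Local gap bound for one stage *)

Section StageGap.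
Context {R : realType} {X Y : normedModType R}.
Variables (P : spp X Y) (hP : spp_assumptions P) (mu_gt0 : 0 < mu P).
Variables (hX : X -> \bar R) (hY : Y -> \bar R).
Hypotheses (dgfX : dgf (Xset P) hX) (dgfY : dgf (Yset P) hY).
Hypothesis rescX : rescaled_strongly_convex (Xset P) hX.
Hypothesis ball_dom : [set x : X | `|x| <= 1] `<=` edom hX.
Hypothesis OmegaX_fin : (Omega' hX < +oo)%E.
Hypothesis OmegaY_fin : (Omega (Yset P) hY < +oo)%E.
Variables (c0 : X) (hc0 : dgf_interior (Xset P) hX c0).

Lemma stage_local_gap x0 r (T : nat) xout yout :
  Xset P x0 -> 0 < r -> 0 < alpha_den P hX hY r -> 0 < tau_den P hX hY r T ->
  let OX := OmegaX hX in let OY := OmegaY P hY in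
  3 <= T%:R :> R ->
  4096 * (L P * OX) <= mu P * T%:R ^+ 2 -> 1024 * (Lxx P * OX) <= mu P * T%:R ->
  4096 * (Lyx P * Num.sqrt (OX * OY)) <= mu P * r * T%:R ->
  8192 * (Lyy P * OY) <= mu P * r ^+ 2 * T%:R ->
  subroutine_output P hX hY x0 r T (fun t => 2 / t.+1%:R) (fun=> (alpha_den P hX hY r)^-1)
    (fun t => t%:R * (tau_den P hX hY r T)^-1) (fun t => t.-1%:R / t%:R) xout yout ->
  [/\ Xset P xout, Yset P yout, edom (g_ P) xout & edom (J_ P) yout] /\
  forall u v, Xset P u -> edom (g_ P) u -> `|u - x0| <= r -> Yset P v -> edom (J_ P) v ->
    rsaddle P xout v - rsaddle P u yout <= 3 / 128 * mu P * r ^+ 2.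
Proof.
move=> Xx0 r0 ad0 td0 OX OY T3 hL hLxx hLyx hLyy [x [xb [xt [y [yb [s [run -> ->]]]]]]].
have [_ [hd0 _] _ _] := run.
have T1 : (1 < T)%N by move: T3; rewrite ler_nat; apply: ltnW.
have [|[[_ Xxb _ Yyb] _] /(_ T1) [[_ gxb] [_ Jyb]]] := iterates_feasible P hP hX hY
  ball_dom x0 Xx0 r r0 T _ _ x xb xt y yb s run T; first by rewrite (ltnW T1)/=.
split=> // u v Xu gu ur Yv Jv.
have [hu Du] := rescaled_ball P hX dgfX ball_dom OmegaX_fin x0 r u r0 ur.
have e0 : 0 <= eta P hX hY r by rewrite mulr_ge0 ?divr_ge0 ?sqrtr_ge0// ltW.
have eV0 : 0 <= (eta P hX hY r)^-1 by rewrite invr_ge0.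
have am := eta_amgm P hP hX hY dgfX dgfY rescX ball_dom OmegaX_fin OmegaY_fin c0 hc0
  (y 1%N) hd0 r.
have := subroutine_bound P hP (ltW mu_gt0) hX hY dgfX dgfY rescX ball_dom OmegaY_fin
  c0 hc0 x0 Xx0 r r0 T _ _ _ _ ad0 td0 e0 eV0 erefl erefl
  (fun u u' v v' Xu Xu' Yv Yv' => am u u' v v' r0 Xu Xu' Yv Yv')
  x xb xt y yb s run u v T1 Xu gu hu Yv Jv.
apply: (stage_arith R T%:R r (mu P) _ (L P) (Lxx P) (Lyx P) (Lyy P) (eta P hX hY r)
  (eta P hX hY r)^-1 _ _ OX OY (Num.sqrt (OX * OY))) => //.
- exact: Lyx_ge0.
- exact: ltW.
- exact: (eta_OmegaX P hX hY dgfX dgfY ball_dom OmegaX_fin OmegaY_fin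
    (y 1%N) hd0 r r0).
- exact: (eta_OmegaY P hX hY dgfX dgfY ball_dom OmegaX_fin OmegaY_fin
    (y 1%N) hd0 r r0).
Qed.

End StageGap.

(** * Number of stages and sums over their radii *)

Lemma natr_ceil (R : realType) (m : R) : 0 <= m ->
  (`|Num.ceil m|%N)%:R = (Num.ceil m)%:~R :> R.
Proof.
move=> m0; rewrite natr_absz ger0_norm// -(ler_int R).
exact: le_trans m0 (ceil_ge m).
Qed.

Lemma natr_ceil_bounds (R : realType) (m : R) : 0 <= m ->
  m <= (`|Num.ceil m|%N)%:R < m + 1.
Proof.
move=> m0; rewrite natr_ceil// ceil_ge/=.
by have := ceilB1_lt m; rewrite intrB ltrBlDr.
Qed.

(** [c] is an upper bound for 1 / (s - 1), so that a rational constant can be used when s is the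
    square root of 2. *)
Lemma geometric_sum_le (R : realFieldType) (s c : R) (n : nat) :
  0 <= s -> 0 <= c -> 1 <= c * (s - 1) -> \sum_(0 <= j < n) s ^+ j <= c * s ^+ n.
Proof.
move=> s0 c0 sc; elim: n => [|n IH]; first by rewrite big_geq// expr0 mulr1.
rewrite big_nat_recr//= exprS.
have := ler_wpM2r (exprn_ge0 n s0) sc; lra.
Qed.

Section StageCount.
Context {R : realType} {X Y : normedModType R}.
Variables (P : spp X Y) (U eps : R).
Hypotheses (U_gt0 : 0 < U) (eps_gt0 : 0 < eps) (eps_le : eps <= mu P * U ^+ 2 / 4).

Let ratio := mu P * U ^+ 2 / (4 * eps).

Let ratio_ge1 : 1 <= ratio.
Proof. by rewrite /ratio ler_pdivlMr ?mulr_gt0// mul1r -ler_pdivlMl// mulrC. Qed.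

Let log2_ge0 : 0 <= log2 ratio.
Proof. by rewrite divr_ge0 ?ln_ge0// ler1n. Qed.

Lemma num_stagesE : (num_stages P U eps)%:R = (Num.ceil (log2 ratio))%:~R + 1 :> R.
Proof. by rewrite /num_stages max_r// -natr1 natr_ceil. Qed.

(** The lower bound yields the final accuracy, the upper bound the total cost. *)
Lemma num_stages_bounds : ratio <= 2 ^+ (num_stages P U eps).-1 <= 2 * ratio.
Proof.
have ln2 : 0 < ln 2 :> R by rewrite ln_gt0// ltr1n.
have ratio_gt0 : 0 < ratio by apply: lt_le_trans ratio_ge1.
have /andP[] := natr_ceil_bounds _ _ log2_ge0.
rewrite /num_stages max_r//= -/ratio; move: (`|_|%N) => n.
rewrite /log2 ler_pdivrMr// => le_n /ltW; rewrite -lerBlDr ler_pdivlMr// => ge_n.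
rewrite -ler_ln ?posrE// -[X in _ && X]ler_ln ?posrE//; last first.
  by rewrite pmulr_rgt0.
rewrite lnXn// lnM ?posrE// -(mulr_natl (ln 2)).
apply/andP; split; lra.
Qed.

Lemma expr2_num_stages_le : 2 ^+ num_stages P U eps <= mu P * U ^+ 2 / eps.
Proof.
have /andP[_] := num_stages_bounds.
have -> : num_stages P U eps = (num_stages P U eps).-1.+1 by [].
rewrite [2 ^+ _.+1]exprS /= => /(ler_wpM2l (ler0n R 2)) /le_trans; apply.
rewrite le_eqVlt; apply/orP; left; apply/eqP; rewrite /ratio.
by field; rewrite gt_eqF.
Qed.

Lemma stage_radiusE j : stage_radius U j.+1 = 2 * U / Num.sqrt 2 ^+ j.
Proof.
rewrite /stage_radius /=; elim: j => [|j /= ->]; first by rewrite expr0 divr1.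
by rewrite exprS invfM mulrA mulrAC.
Qed.

Let sqrt2_gt0 : 0 < Num.sqrt 2 :> R. Proof. by rewrite sqrtr_gt0. Qed.

Lemma stage_radius_gt0 j : 0 < stage_radius U j.+1.
Proof. by rewrite stage_radiusE divr_gt0 ?mulr_gt0 ?exprn_gt0. Qed.

Lemma stage_radius_sqr j : stage_radius U j.+1 ^+ 2 = 4 * U ^+ 2 / 2 ^+ j.
Proof.
rewrite stage_radiusE expr_div_n -exprM mulnC exprM sqr_sqrtr//.
by congr (_ / _); ring.
Qed.

(** Carries the invariant that the saddle point is within half a radius of the center to the next
    stage. *)
Lemma stage_radius_half j : stage_radius U j.+1 / 4 <= stage_radius U j.+2 / 2.
Proof.
have s2 : Num.sqrt 2 <= 2 :> R.
  by rewrite -[leRHS]ger0_norm// -sqrtr_sqr ler_wsqrtr// -natrX ler_nat.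
have -> : stage_radius U j.+2 = stage_radius U j.+1 / Num.sqrt 2 by [].
rewrite -subr_ge0 (_ : _ - _ = stage_radius U j.+1 * (2 - Num.sqrt 2) / (4 * Num.sqrt 2)).
  rewrite divr_ge0 ?mulr_ge0 ?subr_ge0// ltW// ?stage_radius_gt0//.
by field; rewrite gt_eqF.
Qed.

Lemma sum_inv_radius : \sum_(0 <= j < num_stages P U eps) (stage_radius U j.+1)^-1 <=
  2 * Num.sqrt (mu P / eps).
Proof.
have s14 : 14 / 10 <= Num.sqrt 2 :> R.
  rewrite -[leLHS]ger0_norm ?divr_ge0// -sqrtr_sqr ler_wsqrtr//; lra.
have -> : \sum_(0 <= j < num_stages P U eps) (stage_radius U j.+1)^-1 =
    (2 * U)^-1 * \sum_(0 <= j < num_stages P U eps) Num.sqrt 2 ^+ j.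
  rewrite big_distrr; apply: eq_bigr => j _.
  by rewrite stage_radiusE invf_div mulrC.
(* 5/2 bounds 1 / (sqrt 2 - 1), as sqrt 2 >= 14/10; the sum is then at most 5/4 sqrt (mu / eps),
   well below the claim. *)
have c0 : 0 <= 5 / 2 :> R by rewrite divr_ge0.
have c1 : 1 <= 5 / 2 * (Num.sqrt 2 - 1) :> R by lra.
have sum_le := geometric_sum_le R _ _ (num_stages P U eps) (ltW sqrt2_gt0) c0 c1.
have U2 : 0 < (2 * U)^-1 by rewrite invr_gt0 mulr_gt0.
apply: (@le_trans _ _ ((2 * U)^-1 * (5 / 2 * (U * Num.sqrt (mu P / eps))))).
  rewrite (ler_pM2l U2); apply: le_trans sum_le _.
  rewrite ler_pM2l ?divr_gt0//.
  have -> : Num.sqrt 2 ^+ num_stages P U eps = Num.sqrt (2 ^+ num_stages P U eps) :> R.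
    by elim: (num_stages _ _ _) => [|k IH]; rewrite ?expr0 ?sqrtr1// !exprS IH sqrtrM.
  have -> : U * Num.sqrt (mu P / eps) = Num.sqrt (U ^+ 2 * (mu P / eps)).
    by rewrite [RHS]sqrtrM ?sqr_ge0// sqrtr_sqr gtr0_norm.
  by apply: ler_wsqrtr; rewrite mulrCA mulrA; exact: expr2_num_stages_le.
have s0 : 0 <= Num.sqrt (mu P / eps) by rewrite sqrtr_ge0.
move: s0; move: (Num.sqrt _) => z z0.
have -> : (2 * U)^-1 * (5 / 2 * (U * z)) = 5 / 4 * z by field; rewrite gt_eqF.
by apply: ler_wpM2r => //; rewrite ler_pdivrMr// -natrM ler_nat.
Qed.

Lemma sum_inv_sqr_radius :
  \sum_(0 <= j < num_stages P U eps) (stage_radius U j.+1 ^+ 2)^-1 <= mu P / (4 * eps).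
Proof.
have -> : \sum_(0 <= j < num_stages P U eps) (stage_radius U j.+1 ^+ 2)^-1 =
    (4 * U ^+ 2)^-1 * \sum_(0 <= j < num_stages P U eps) 2 ^+ j.
  rewrite big_distrr; apply: eq_bigr => j _.
  by rewrite stage_radius_sqr invf_div mulrC.
have U2 : 0 < 4 * U ^+ 2 by rewrite mulr_gt0 ?exprn_gt0.
rewrite mulrC ler_pdivrMr//.
have two1 : 1 <= 1 * (2 - 1) :> R by lra.
have := geometric_sum_le R 2 1 (num_stages P U eps) (ler0n R 2) ler01 two1.
move=> /le_trans; apply; rewrite mul1r; apply: le_trans expr2_num_stages_le _.
rewrite le_eqVlt; apply/orP; left; apply/eqP.
by field; rewrite gt_eqF.
Qed.

Lemma last_radius : mu P * stage_radius U (num_stages P U eps) ^+ 2 <= 16 * eps.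
Proof.
have /andP[+ _] := num_stages_bounds; rewrite /num_stages /= stage_radius_sqr.
move: (`|_|%N) => n; rewrite /ratio ler_pdivrMr ?mulr_gt0// => le_n.
have p0 : 0 < 2 ^+ n :> R by rewrite exprn_gt0.
rewrite mulrA ler_pdivrMr//; lra.
Qed.

End StageCount.

(** * Lower and upper bounds on the length of a stage *)

Section StageLength.
Context {R : realType} {X Y : normedModType R}.
Variables (P : spp X Y) (hP : spp_assumptions P) (mu_gt0 : 0 < mu P).
Variables (hX : X -> \bar R) (hY : Y -> \bar R) (U : R) (k : nat).
Hypotheses (OX_ge0 : 0 <= OmegaX hX) (OY_ge0 : 0 <= OmegaY P hY).
Hypothesis r_gt0 : 0 < stage_radius U k.

Let OX := OmegaX hX.
Let OY := OmegaY P hY.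
Let r := stage_radius U k.
Let T : R := (stage_length P hX hY U k)%:R.

Lemma stage_length_ge : [/\ 3 <= T, 4096 * (L P * OX) <= mu P * T ^+ 2,
  1024 * (Lxx P * OX) <= mu P * T,
  4096 * (Lyx P * Num.sqrt (OX * OY)) <= mu P * r * T &
  8192 * (Lyy P * OY) <= mu P * r ^+ 2 * T].
Proof.
rewrite /T /stage_length -/OX -/OY -/r; set m := Num.max 3 _.
have m0 : 0 <= m by rewrite le_max ler0n.
have /andP[mT _] := natr_ceil_bounds R m m0.
move: mT; move: (_%:R) => t; rewrite /m !ge_max.
case/andP=> t3 /andP[tL] /andP[tLxx] /andP[tLyx tLyy].
have t0 : 0 <= t by apply: le_trans t3.
have mur : 0 < mu P * r by rewrite mulr_gt0.
have mur2 : 0 < mu P * r ^+ 2 by rewrite mulr_gt0// exprn_gt0.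
split=> //.
- have z0 : 0 <= L P / mu P * OX.
    by rewrite mulr_ge0// divr_ge0 ?(L_ge0 hP)// ltW.
  have : (64 * Num.sqrt (L P / mu P * OX)) ^+ 2 <= t ^+ 2.
    by rewrite ler_pXn2r// nnegrE mulr_ge0 ?sqrtr_ge0.
  rewrite exprMn sqr_sqrtr// => /(ler_wpM2l (ltW mu_gt0)).
  congr (_ <= _); field; exact: lt0r_neq0.
- move: tLxx => /(ler_wpM2l (ltW mu_gt0)).
  congr (_ <= _); field; exact: lt0r_neq0.
- move: tLyx => /(ler_wpM2l (ltW mur)).
  congr (_ <= _); field; rewrite !gt_eqF//.
- move: tLyy => /(ler_wpM2l (ltW mur2)).
  congr (_ <= _); field; rewrite !gt_eqF//.
Qed.

(** Rounding up costs less than 1. If 3 is the maximum, integrality gives T <= 3; otherwise the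
    summand 3 on the right pays for the rounding. *)
Lemma stage_length_le :
  T <= (3 + 64 * Num.sqrt (L P / mu P * OX) + 1024 * (Lxx P / mu P) * OX)
    + 4096 * (Lyx P / mu P) * Num.sqrt (OX * OY) * r^-1
    + 8192 * (Lyy P / mu P) * OY * (r ^+ 2)^-1.
Proof.
rewrite /T /stage_length -/OX -/OY -/r; set m := Num.max 3 _.
have m0 : 0 <= m by rewrite le_max ler0n.
have /andP[_] := natr_ceil_bounds R m m0.
set n := `|_|%N; rewrite -ltrBlDr.
have mu0 := ltW mu_gt0.
have r0 := ltW r_gt0.
have a0 : 0 <= 64 * Num.sqrt (L P / mu P * OX) by rewrite mulr_ge0 ?sqrtr_ge0.
have scaled_ge0 (c : nat) (a b : R) : 0 <= a -> 0 <= b -> 0 <= c%:R * (a / mu P) * b.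
  by move=> a_ge0 b_ge0; rewrite mulr_ge0// mulr_ge0 ?divr_ge0.
have b0 := scaled_ge0 1024%N _ _ (Lxx_ge0 hP) OX_ge0.
have c0 := mulr_ge0 (scaled_ge0 4096%N _ _ (Lyx_ge0 hP) (sqrtr_ge0 (OX * OY)))
  (ltW (etrans (invr_gt0 r) r_gt0)).
have d0 := mulr_ge0 (scaled_ge0 8192%N _ _ (Lyy_ge0 hP) OY_ge0)
  (ltW (etrans (invr_gt0 (r ^+ 2)) (exprn_gt0 2 r_gt0))).
rewrite -/OX -/OY in b0 d0.
rewrite {1}/m 4!lt_max => /orP[n3|].
  have : n%:R < (4%:R : R) by lra.
  rewrite ltr_nat ltnS => n3'; have : n%:R <= (3%:R : R) by rewrite ler_nat.
  lra.
case/or4P; lra.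
Qed.

End StageLength.

Theorem theorem4p1 (R : realType) (X Y : normedModType R)
  (findimX : finite_dimensional X) (findimY : finite_dimensional Y)
  (P : spp X Y) (hP : spp_assumptions P) (mu_gt0 : 0 < mu P)
  (hX : X -> \bar R) (hY : Y -> \bar R)
  (dgfX : dgf (Xset P) hX) (dgfY : dgf (Yset P) hY)
  (rescX : rescaled_strongly_convex (Xset P) hX)
  (ball_dom : [set x : X | `|x| <= 1] `<=` edom hX)
  (OmegaX_fin : (Omega' hX < +oo)%E)
  (bndX : bounded_set (Xset P))
  (OmegaY_fin : (Omega (Yset P) hY < +oo)%E)
  (U eps : R) (hU : (diameter (Xset P) <= U%:E)%E)
  (eps_gt0 : 0 < eps) (eps_le : eps <= mu P * U ^+ 2 / 4)
  (steps : stepsizes_well_defined P hX hY U eps)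
  (x1 : X) (hx1 : dgf_interior (Xset P) hX x1)
  (xs : nat -> X) (ys : nat -> Y)
  (hrun : restart_run P hX hY U eps x1 xs ys) :
  let K := num_stages P U eps in
  let OX := OmegaX hX in
  let OY := OmegaY P hY in
  (gap P (xs K.+1) (ys K.+1) <= eps%:E)%E /\
  (oracle_calls P hX hY U eps)%:R <=
    (3 + 64 * Num.sqrt (L P / mu P * OX) + 1024 * (Lxx P / mu P) * OX)
      * ((Num.ceil (log2 (mu P * U ^+ 2 / (4 * eps))))%:~R + 1)
    + 8192 * (Lyx P / Num.sqrt (mu P * eps)) * Num.sqrt (OX * OY)
    + 2048 * (Lyy P / eps) * OY.
Proof.
move=> K OX OY.
have dist_le u u' : Xset P u -> Xset P u' -> `|u - u'| <= U.
  move=> Xu Xu'; rewrite -lee_fin; apply: le_trans hU.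
  by apply: ereal_sup_ubound; exists u, u'.
have U0 : 0 < U.
  rewrite lt_neqAle (le_trans (normr_ge0 _) (dist_le _ _ hx1.1 hx1.1)) andbT.
  apply/eqP => U0; move: eps_le; rewrite -U0 expr0n/= mulr0 mul0r.
  by rewrite leNgt eps_gt0.
have [xs1 stages] := hrun.
have rpos j : 0 < stage_radius U j.+1 by exact: stage_radius_gt0.
have OX0 : 0 <= OX := OmegaX_ge0 P hX dgfX ball_dom OmegaX_fin.
have OY0 : 0 <= OY.
  (* The initial dual point of the first stage supplies a point of [dgf_interior], needed for the
     sign of [OmegaY]. *)
  have [|x [xb [xt [y [yb [s [[_ [hy _] _ _] _ _]]]]]]] := stages 1%N; first by [].
  exact: (OmegaY_ge0 P hY dgfY OmegaY_fin (y 1%N) hy).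
have [xst [yst sad]] := real_saddle_point_exists P hP.
have [[Xst _ _ _] _] := sad.
pose good k := [/\ Xset P (xs k.+1), Yset P (ys k.+1), edom (g_ P) (xs k.+1) &
    edom (J_ P) (ys k.+1)] /\
  forall u v, Xset P u -> edom (g_ P) u -> Yset P v -> edom (J_ P) v ->
    rsaddle P (xs k.+1) v - rsaddle P u (ys k.+1) <=
      3 / 128 * mu P * stage_radius U k ^+ 2.
have stage j : (j < K)%N -> Xset P (xs j.+1) ->
    `|xst - xs j.+1| <= stage_radius U j.+1 / 2 ->
    good j.+1 /\ `|xst - xs j.+2| <= stage_radius U j.+1 / 4.
  move=> jK Xj near.
  have [alpha0 tau0] := steps j.+1 jK.
  have [T3 hL hLxx hLyx hLyy] := stage_length_ge P hP mu_gt0 hX hY U j.+1 OX0 (rpos j).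
  have [feas loc] := stage_local_gap P hP mu_gt0 hX hY dgfX dgfY rescX ball_dom OmegaX_fin
    OmegaY_fin x1 hx1 (xs j.+1) _ _ (xs j.+2) (ys j.+2) Xj (rpos j) alpha0 tau0
    T3 hL hLxx hLyx hLyy (stages j.+1 jK).
  have [Xb Yb gb Jb] := feas.
  have [near' glob] := gap_localization P hP mu_gt0 xst yst (xs j.+1) _ (xs j.+2) (ys j.+2)
    sad (rpos j) near Xb Yb gb Jb loc.
  by split.
have start j : (j < K)%N ->
    Xset P (xs j.+1) /\ `|xst - xs j.+1| <= stage_radius U j.+1 / 2.
  elim: j => [_|j IH jK].
    rewrite xs1; split; first exact: hx1.1.
    (* Half of the first radius is [U], which bounds every distance in [Xset P]. *)
    rewrite stage_radiusE expr0 divr1 mulrC mulKf//.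
    exact: dist_le Xst hx1.1.
  have [Xj near] := IH (ltnW jK).
  have [[[Xj' _ _ _] _] near'] := stage j (ltnW jK) Xj near.
  by split=> //; apply: le_trans near' (stage_radius_half _ U0 _).
have [n Kn] : exists n, K = n.+1 by exists K.-1.
have nK : (n < K)%N by rewrite Kn.
split.
  have [[[XK YK gK JK] gapK] _] := stage n nK (start n nK).1 (start n nK).2.
  rewrite Kn; apply: ge_ereal_sup => _ [u [v [Xu Yv ->]]].
  (* With mu r^2 <= 16 eps at the last stage, the bound 3/128 mu r^2 is at most 3/8 eps. *)
  have last := last_radius P U eps eps_gt0 eps_le.
  rewrite -/K Kn in last.
  have [gu|] := boolP (g_ P u < +oo)%E; last first.
    rewrite -leNgt leye_eq => /eqP gu; rewrite /saddle gu.
    rewrite -(fineK (f_fin P hP u Xu)) -(fineK (ccp_fin _ _ (J_ccp hP) JK)).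
    by rewrite /= addeNy leNye.
  have [Jv|] := boolP (J_ P v < +oo)%E; last first.
    rewrite -leNgt leye_eq => /eqP Jv; rewrite /saddle Jv.
    rewrite -(fineK (f_fin P hP _ XK)) -(fineK (ccp_fin _ _ (g_ccp hP) gK)).
    by rewrite /= addNye leNye.
  rewrite !rsaddleE// -EFinB lee_fin; apply: le_trans (gapK u v Xu gu Yv Jv) _.
  lra.
rewrite /oracle_calls natr_sum -/K big_add1 /=.
set A := 3 + _ + _.
pose C := 4096 * (Lyx P / mu P) * Num.sqrt (OX * OY).
pose D := 8192 * (Lyy P / mu P) * OY.
have scaled_ge0 (c : nat) (a b : R) : 0 <= a -> 0 <= b -> 0 <= c%:R * (a / mu P) * b.
  by move=> a_ge0 b_ge0; rewrite mulr_ge0// mulr_ge0 ?divr_ge0// ltW.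
have C0 : 0 <= C := scaled_ge0 _ _ _ (Lyx_ge0 hP) (sqrtr_ge0 _).
have D0 : 0 <= D := scaled_ge0 _ _ _ (Lyy_ge0 hP) OY0.
apply: (@le_trans _ _ (\sum_(0 <= j < K) (A + C * (stage_radius U j.+1)^-1
    + D * (stage_radius U j.+1 ^+ 2)^-1))).
  by apply: ler_sum => j _; exact: stage_length_le.
clearbody A; rewrite big_split big_split/= -!big_distrr/= sumr_const_nat subn0.
(* The factors 2 and 1/4 of the two sums turn 4096 into 8192 and 8192 into 2048. *)
have sum1 := ler_wpM2l C0 (sum_inv_radius P U eps U0 eps_gt0 eps_le).
have sum2 := ler_wpM2l D0 (sum_inv_sqr_radius P U eps U0 eps_gt0 eps_le).
have KE : K%:R = _ := num_stagesE P U eps eps_gt0 eps_le.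
rewrite -(mulr_natr A) KE lerD ?lerD//.
- apply: le_trans sum1 _; rewrite /C.
  have mu0 := ltW mu_gt0; have eps0 := ltW eps_gt0.
  have -> : Num.sqrt (mu P / eps) = Num.sqrt (mu P) / Num.sqrt eps.
    by rewrite sqrtrM ?sqrtrV.
  have -> : Num.sqrt (mu P * eps) = Num.sqrt (mu P) * Num.sqrt eps by rewrite sqrtrM.
  have -> : Lyx P / mu P = Lyx P / Num.sqrt (mu P) ^+ 2 by rewrite sqr_sqrtr.
  rewrite le_eqVlt; apply/orP; left; apply/eqP.
  have : Num.sqrt (mu P) != 0 by rewrite sqrtr_eq0 -ltNge.
  have : Num.sqrt eps != 0 by rewrite sqrtr_eq0 -ltNge.
  move: (Num.sqrt eps) (Num.sqrt (mu P)) (Num.sqrt (OX * OY)) => b a w b0 a0; field.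
  by rewrite a0 b0.
- apply: le_trans sum2 _; rewrite /D le_eqVlt; apply/orP; left; apply/eqP.
  by field; rewrite !gt_eqF.
Qed.
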